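(* Let $1\le p\le\infty$, $k\in\mathbb{N}=\{1,2,\dots\}$, let $\Omega\subset\mathbb{R}$ be a bounded open interval with fixed base point $x_0\in\Omega$, and let $W^{k,p}(\Omega)$ be the anchored ordered Sobolev space with base point $x_0$. Let $\{\ast^{(j)}:j=0,\ldots,k-1\}$ be a set of $k$ distinct points disjoint from $\Omega$, and let $X=\{\ast^{(j)}:j=0,\ldots,k-1\}\sqcup\Omega$. Define the $\sigma$-algebra $\mathfrak{A}=\{A\subseteq X:A\cap\Omega\in\mathcal{L}(\Omega)\}$ and the measure $\mu(E)=m(E\cap\Omega)+\sum_{j=0}^{k-1}\delta_{\ast^{(j)}}(E)$ for $E\in\mathfrak{A}$. Then $W^{k,p}(\Omega)$ is complex-linearly isometric and order isomorphic to $L^p(X,\mathfrak{A},\mu)$, i.e. there exists a complex-linear isometric order isomorphism from $W^{k,p}(\Omega)$ onto $L^p(X,\mathfrak{A},\mu)$.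
   Context: $m$ is Lebesgue measure on $\Omega$, $\mathcal{L}(\Omega)$ its Lebesgue $\sigma$-algebra, and $\delta_{\ast^{(j)}}$ the Dirac measure at $\ast^{(j)}$. All function spaces are complex. $W^{k,p}_{\mathbb{C}}(\Omega)$ is the complex vector space of $f\in L^p(\Omega)$ having weak derivatives $f^{(j)}\in L^p(\Omega)$ for $j=1,\ldots,k$; $f^{(0)}=f$; for $0\le j\le k-1$, $f^{(j)}$ is identified with its absolutely continuous representative, so $f^{(j)}(x_0)$ is well defined. $W^{k,p}_{\mathbb{R}}(\Omega)$ is the real subspace of real-valued functions. The anchored norm is $\|f\|_{k,p}=\big(\sum_{j=0}^{k-1}|f^{(j)}(x_0)|^p+\|f^{(k)}\|_p^p\big)^{1/p}$ for $1\le p<\infty$ and $\|f\|_{k,\infty}=\max\{\max_{0\le j<k}|f^{(j)}(x_0)|,\ \|f^{(k)}\|_\infty\}$ for $p=\infty$. The positive cone is $W^{k,p}(\Omega)^+=\{f\in W^{k,p}_{\mathbb{R}}(\Omega): f^{(k)}\ge0\text{ a.e.},\ f^{(j)}(x_0)\ge0\ \text{for } j=0,\ldots,k-1\}$. $W^{k,p}(\Omega)$ denotes $W^{k,p}_{\mathbb{C}}(\Omega)$ with this norm and the order induced by this cone. $L^p(X,\mathfrak{A},\mu)$ carries its usual norm and the positive cone of functions that are $\ge0$ $\mu$-a.e. A complex-linear isometric order isomorphism $\Phi:E\to F$ between ordered Banach spaces with positive cones $E^+,F^+$ is a complex-linear surjective isometry with $\Phi(E^+)=F^+$ and $\Phi^{-1}(F^+)=E^+$.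 *)

(* Defs.v *)
From HB Require Import structures.
From mathcomp Require Import all_boot all_order all_algebra.
From mathcomp Require Import generic_quotient ring_quotient complex.
From mathcomp Require Import all_classical all_reals all_analysis.
From mathcomp Require Import measurable_realfun ess_sup_inf hoelder.

Set Implicit Arguments.
Unset Strict Implicit.
Unset Printing Implicit Defensive.
Import Order.TTheory GRing.Theory Num.Theory.
Import numFieldNormedType.Exports.
Import Normc.

Local Open Scope classical_set_scope.
Local Open Scope ring_scope.
Local Open Scope complex_scope.

Section complex_Lp_functions.
Context d (T : measurableType d) (R : realType).
Implicit Types (f g : T -> R[i]).

(* Borel measurability into C = R x R, componentwise. *)
Definition cmeasurable f :=
  measurable_fun [set: T] (fun x => complex.Re (f x)) /\
  measurable_fun [set: T] (fun x => complex.Im (f x)).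

Definition cLnorm (mu : {measure set T -> \bar R}) (p : \bar R) f : \bar R :=
  ('N[mu]_p[EFin \o (@normc R \o f)])%E.

Variables (mu : {measure set T -> \bar R}) (p : \bar R).

Lemma normc_ge0 (z : R[i]) : 0 <= normc z.
Proof. by case: z => a b; exact: sqrtr_ge0. Qed.

Lemma measurable_normc f : cmeasurable f ->
  measurable_fun [set: T] (fun x => normc (f x)).
Proof.
case=> mr mi.
have -> : (fun x => normc (f x)) =
    (fun x => Num.sqrt (complex.Re (f x) ^+ 2 + complex.Im (f x) ^+ 2)).
  by apply/funext => x; case: (f x).
apply: (@measurableT_comp _ _ _ _ _ _ (@Num.sqrt R)).
  by apply: continuous_measurable_fun; exact: sqrt_continuous.
by apply: measurable_funD; exact: measurable_funX.
Qed.

Lemma le_cLnorm (u v : T -> R) : (1 <= p)%E ->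
  measurable_fun setT u -> measurable_fun setT v ->
  (forall x, 0 <= u x <= v x) ->
  ('N[mu]_p[EFin \o u] <= 'N[mu]_p[EFin \o v])%E.
Proof.
move=> p1 mu_ mv uv; rewrite unlock /Lnorm.
have u0 x : 0 <= u x by have /andP[] := uv x.
have v0 x : 0 <= v x by rewrite (le_trans (u0 x))//; have /andP[] := uv x.
case: p p1 => [r|//|//] => [r1|_].
  have r0 : 0 <= r by rewrite -lee_fin (le_trans _ r1)// lee_fin.
  apply: gt0_ler_poweR => //.
  - by rewrite invr_ge0.
  - by rewrite in_itv/= leey andbT; apply: integral_ge0 => x _; rewrite lee_fin powR_ge0.
  - by rewrite in_itv/= leey andbT; apply: integral_ge0 => x _; rewrite lee_fin powR_ge0.
  apply: ge0_le_integral => //=.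
  - apply: (@measurableT_comp _ _ _ _ _ _ (fun x : R => (`|x| `^ r)%:E)) => //.
    apply/measurable_EFinP.
    apply: (@measurableT_comp _ _ _ _ _ _ (@powR R ^~ r)) => //.
  - apply: (@measurableT_comp _ _ _ _ _ _ (fun x : R => (`|x| `^ r)%:E)) => //.
    apply/measurable_EFinP.
    apply: (@measurableT_comp _ _ _ _ _ _ (@powR R ^~ r)) => //.
  move=> x _; rewrite lee_fin ge0_ler_powR ?nnegrE//.
  by rewrite !ger0_norm//; have /andP[] := uv x.
case: ifPn => // _; apply: le_ess_sup; apply: aeW => x /=.
by rewrite lee_fin !ger0_norm//; have /andP[] := uv x.
Qed.

Lemma cmeasurable0 : cmeasurable (0 : T -> R[i]).
Proof. by split; exact: measurable_cst. Qed.

Lemma cmeasurableD f g : cmeasurable f -> cmeasurable g -> cmeasurable (f + g).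
Proof.
move=> [fr fi] [gr gi]; split.
  rewrite (_ : (fun x => _) =
      (fun x => complex.Re (f x) + complex.Re (g x))) ?raddfD//.
    exact: measurable_funD.
  by apply/funext => x; rewrite !fctE; case: (f x) (g x) => [? ?] [? ?].
rewrite (_ : (fun x => _) = (fun x => complex.Im (f x) + complex.Im (g x))).
  exact: measurable_funD.
by apply/funext => x; rewrite !fctE; case: (f x) (g x) => [? ?] [? ?].
Qed.

Lemma cmeasurableZ (c : R[i]) f : cmeasurable f -> cmeasurable (c *: f).
Proof.
move=> [fr fi]; split.
  rewrite (_ : (fun x => _) = (fun x => complex.Re c * complex.Re (f x) -
      complex.Im c * complex.Im (f x))).
    by apply: measurable_funB; apply: measurable_funM.
  by apply/funext => x; rewrite !fctE; case: c (f x) => [? ?] [? ?].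
rewrite (_ : (fun x => _) = (fun x => complex.Re c * complex.Im (f x) +
    complex.Im c * complex.Re (f x))).
  by apply: measurable_funD; apply: measurable_funM.
by apply/funext => x; rewrite !fctE; case: c (f x) => [? ?] [? ?].
Qed.

Definition cLfun (p1 : (1 <= p)%E) : {pred T -> R[i]} :=
  mem [set f | cmeasurable f /\ (cLnorm mu p f < +oo)%E].

Variable p1 : (1 <= p)%E.

Lemma cLnormD f g : cmeasurable f -> cmeasurable g ->
  (cLnorm mu p (f + g)%R <= cLnorm mu p f + cLnorm mu p g)%E.
Proof.
move=> mf mg; apply: (@le_trans _ _
    ('N[mu]_p[EFin \o ((@normc R \o f) \+ (@normc R \o g))%R])%E).
  apply: le_cLnorm => //.
  - exact/measurable_normc/cmeasurableD.
  - by apply: measurable_funD; exact: measurable_normc.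
  - by move=> x; rewrite normc_ge0 le_normcD.
by apply: eminkowski => //; exact: measurable_normc.
Qed.

Lemma cLfun_submod_closed : submod_closed (cLfun p1).
Proof.
split.
  rewrite inE; split; first exact: cmeasurable0.
  rewrite /cLnorm (_ : EFin \o _ = cst 0%E).
    by rewrite Lnorm0// gt_eqF// (lt_le_trans _ p1).
  by apply/funext => x /=; congr EFin; exact: normc0.
move=> c f g; rewrite !inE => -[mf lf] [mg lg].
split; first by apply: cmeasurableD => //; exact: cmeasurableZ.
apply: (le_lt_trans (cLnormD _ _)) => //; first exact: cmeasurableZ.
apply: lte_add_pinfty => //.
have mnf := measurable_normc mf.
pose F : LfunType mu p1 := Lfun_Sub p1 (f := @normc R \o f) (introT andP (conj (mem_set mnf) (mem_set lf))).
rewrite (_ : cLnorm _ _ _ = ('N[mu]_p[EFin \o (normc c \*: F)])%E).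
  by rewrite LnormZ lte_mul_pinfty// lee_fin.
congr Lnorm; apply/funext => x /=.
by rewrite fctE normcM.
Qed.

HB.instance Definition _ := GRing.isSubmodClosed.Build _ _ (cLfun p1)
  cLfun_submod_closed.

Record cLfunType := CLfun { cLfun_fun :> T -> R[i] ; _ : cLfun_fun \in cLfun p1 }.
HB.instance Definition _ := [isSub for cLfun_fun].
HB.instance Definition _ := [Choice of cLfunType by <:].
HB.instance Definition _ := [SubChoice_isSubLmodule of cLfunType by <:].

(* Lp elements are classes of functions modulo a.e. equality: Lp is the quotient
   of the p-integrable functions by the a.e. null ones. *)
Definition ae_null : {pred cLfunType} := mem [set f : cLfunType | {ae mu, forall x, f x = 0}].

Lemma ae_null_submod_closed : submod_closed ae_null.
Proof.
split; first by rewrite inE; exact: aeW.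
move=> c f g; rewrite !inE; apply: filterS2 => x /= f0 g0.
by rewrite -[LHS]/(c *: f x + g x) f0 g0 scaler0 addr0.
Qed.

HB.instance Definition _ := GRing.isSubmodClosed.Build _ _ ae_null
  ae_null_submod_closed.

Import Quotient.
Definition Lp : Type := {quot ae_null}.
HB.instance Definition _ := GRing.Zmodule.on Lp.

End complex_Lp_functions.
Arguments ae_null {d T R} mu {p} p1.

Section Lp_space.
Context d (T : measurableType d) (R : realType).
Variables (mu : {measure set T -> \bar R}) (p : \bar R) (p1 : (1 <= p)%E).
Local Open Scope quotient_scope.

Definition Lp_repr (x : Lp mu p1) : T -> R[i] := repr x.
Coercion Lp_repr : Lp >-> Funclass.

Definition Lp_class (f : cLfunType mu p1) : Lp mu p1 := \pi_(Lp mu p1) f.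

Lemma Lp_ind (P : Lp mu p1 -> Prop) : (forall f, P (Lp_class f)) -> forall x, P x.
Proof. by move=> Pf x; rewrite -[x](@reprK _ (Lp mu p1)); exact: Pf. Qed.

Lemma ae_Lp_class (f : cLfunType mu p1) : {ae mu, forall t, Lp_class f t = f t}.
Proof.
have : repr (Lp_class f) - f \in ae_null mu p1.
  by rewrite Quotient.idealrBE reprK.
by rewrite inE; apply: filterS => t /eqP; rewrite subr_eq0 => /eqP.
Qed.

Lemma eq_Lp_class (f g : cLfunType mu p1) :
  {ae mu, forall t, f t = g t} -> Lp_class f = Lp_class g.
Proof.
move=> fg; apply/eqP; rewrite -Quotient.idealrBE inE.
by move: fg; apply: filterS => t /eqP; rewrite -subr_eq0 => /eqP.
Qed.

Lemma Lp_classD (f g : cLfunType mu p1) :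
  Lp_class f + Lp_class g = Lp_class (f + g).
Proof. exact/esym/Quotient.pi_add. Qed.

Lemma Lp_class0 : Lp_class 0 = 0.
Proof. by apply: (addrI (Lp_class 0)); rewrite Lp_classD !addr0. Qed.

Definition Lp_scale (c : R[i]) (x : Lp mu p1) : Lp mu p1 :=
  Lp_class (c *: repr x).

Lemma Lp_class_scale c (f : cLfunType mu p1) :
  Lp_scale c (Lp_class f) = Lp_class (c *: f).
Proof.
apply: eq_Lp_class; have := ae_Lp_class f; apply: filterS => t ft.
by rewrite -[LHS]/(c *: Lp_repr _ t) ft.
Qed.

Let scaleA a b x : Lp_scale a (Lp_scale b x) = Lp_scale (a * b) x.
Proof. by elim/Lp_ind: x => f; rewrite !Lp_class_scale scalerA. Qed.

Let scale1 : left_id 1 Lp_scale.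
Proof. by elim/Lp_ind => f; rewrite Lp_class_scale scale1r. Qed.

Let scaleDr : right_distributive Lp_scale +%R.
Proof.
move=> c; elim/Lp_ind => f; elim/Lp_ind => g.
by rewrite Lp_classD !Lp_class_scale scalerDr Lp_classD.
Qed.

Let scaleDl x : {morph Lp_scale^~ x : a b / a + b}.
Proof.
by move=> a b; elim/Lp_ind: x => f; rewrite !Lp_class_scale scalerDl Lp_classD.
Qed.

HB.instance Definition _ := GRing.Zmodule_isLmodule.Build R[i] (Lp mu p1)
  scaleA scale1 scaleDr scaleDl.

Lemma ae_Lp_linear c (x y : Lp mu p1) :
  {ae mu, forall t, Lp_repr (c *: x + y) t = c * x t + y t}.
Proof.
elim/Lp_ind: x => f; elim/Lp_ind: y => g.
rewrite -[c *: _]/(Lp_scale c _) Lp_class_scale Lp_classD.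
have := ae_Lp_class (c *: f + g); have := ae_Lp_class f; have := ae_Lp_class g.
by apply: filterS3 => t -> -> ->.
Qed.

Lemma ae_Lp0 : {ae mu, forall t, (0 : Lp mu p1) t = 0}.
Proof. by rewrite -Lp_class0; exact: ae_Lp_class. Qed.

Lemma LpP (x : Lp mu p1) : cmeasurable x /\ (cLnorm mu p x < +oo)%E.
Proof. by have := valP (repr x); rewrite inE. Qed.

Definition Lp_norm (x : Lp mu p1) : R := fine (cLnorm mu p x).

(* The order of R[i] makes 0 <= z mean that z is real and nonnegative. *)
Definition Lp_cone : set (Lp mu p1) := [set x : Lp mu p1 | {ae mu, forall t, 0 <= x t}].

End Lp_space.
Arguments Lp_norm {d T R} mu {p} p1 x.
Arguments Lp_cone {d T R} mu {p} p1.

Section interval_space.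
Context {R : realType} {a b x0 : R}.

(* The open interval ]a, b[ as a type; x0 is only used as its canonical point. *)
Definition interval_space (x0ab : x0 \in `]a, b[) : Type := {x : R | x \in `]a, b[}.

Variable x0ab : x0 \in `]a, b[.
Local Notation Omega := (interval_space x0ab).

Definition interval_val (x : Omega) : R := sval x.
Coercion interval_val : interval_space >-> Real.sort.

HB.instance Definition _ := Choice.copy Omega {x : R | x \in `]a, b[}.
Definition base_point : Omega := exist _ x0 x0ab.
HB.instance Definition _ := isPointed.Build Omega base_point.

(* Caratheodory-measurable sets for the outer measure extending interval length,
   i.e. the domain of completed_lebesgue_measure. *)
Definition lebesgue_measurable : set (set R) :=
  @measurable _ (caratheodory_type (R := R) (T := ocitv_type R) (wlength idfun)^*%mu).

Definition interval_measurable : set (set Omega) :=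
  [set A | lebesgue_measurable (interval_val @` A)].

Definition interval_measure (A : set Omega) : \bar R :=
  completed_lebesgue_measure (interval_val @` A).

Lemma interval_val_inj : injective interval_val.
Proof. exact: val_inj. Qed.

Lemma image_interval_val (A : set Omega) (B : set R) :
  (forall x : Omega, A x <-> B x) -> interval_val @` A = B `&` [set` `]a, b[].
Proof.
move=> AB; apply/seteqP; split=> [_ [x Ax <-]|x [Bx xab]].
  by split; [exact/AB|exact: (svalP x)].
by exists (exist _ x xab) => //; apply/AB.
Qed.

Lemma lebesgue_measurable_itv (i : interval R) : lebesgue_measurable [set` i].
Proof. by apply: sub_caratheodory; exact: measurable_itv. Qed.

Let measurable0 : interval_measurable set0.
Proof. by rewrite /interval_measurable/= image_set0; exact: measurable0. Qed.

Let measurableC A : interval_measurable A -> interval_measurable (~` A).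
Proof.
rewrite /interval_measurable/= => mA.
rewrite (@image_interval_val _ (~` (interval_val @` A))); last first.
  move=> x; split=> [nAx [y Ay /interval_val_inj yx]|nAx Ax].
    by rewrite yx in Ay.
  by apply: nAx; exists x.
by apply: measurableI; [exact: measurableC|exact: lebesgue_measurable_itv].
Qed.

Let measurable_bigcup (F : (set Omega)^nat) :
  (forall i, interval_measurable (F i)) -> interval_measurable (\bigcup_i F i).
Proof.
move=> mF; rewrite /interval_measurable/= image_bigcup.
exact: bigcupT_measurable.
Qed.

HB.instance Definition _ := @isMeasurable.Build default_measure_display Omega
  interval_measurable measurable0 measurableC measurable_bigcup.

Let measure0 : interval_measure set0 = 0%E.
Proof. by rewrite /interval_measure image_set0 measure0. Qed.

Let measure_ge0 A : (0 <= interval_measure A)%E.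
Proof. exact: measure_ge0. Qed.

Let measure_sigma_additive : semi_sigma_additive interval_measure.
Proof.
move=> F mF tF mUF; rewrite /interval_measure image_bigcup.
apply: measure_semi_sigma_additive => //.
  apply/trivIsetP => i j _ _ ij; rewrite -subset0 => _ [[x Fix <-] [y Fjy]].
  move/interval_val_inj => yx; rewrite yx in Fjy.
  by move/trivIsetP : tF => /(_ i j Logic.I Logic.I ij); rewrite -subset0 => /(_ x); exact.
by rewrite -image_bigcup.
Qed.

HB.instance Definition _ := isMeasure.Build _ Omega R interval_measure
  measure0 measure_ge0 measure_sigma_additive.

End interval_space.
Arguments interval_measure {R a b x0} x0ab A.

Section anchored_space.
Context {R : realType} {a b x0 : R}.
Variables (x0ab : x0 \in `]a, b[) (k : nat).
Local Notation Omega := (interval_space x0ab).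
Local Notation m := (interval_measure x0ab).

(* inl j is the j-th added atom and inr the inclusion of the interval, so that
   intersecting with the interval is taking the preimage under inr. *)
Definition anchored_space : Type := ('I_k + Omega)%type.

HB.instance Definition _ := Choice.copy anchored_space ('I_k + Omega)%type.
HB.instance Definition _ := isPointed.Build anchored_space (inr (base_point x0ab)).

Definition anchored_measurable : set (set anchored_space) :=
  [set A | measurable ((inr : Omega -> anchored_space) @^-1` A)].

Let measurable0 : anchored_measurable set0.
Proof. by rewrite /anchored_measurable/= preimage_set0; exact: measurable0. Qed.

Let measurableC A : anchored_measurable A -> anchored_measurable (~` A).
Proof. by rewrite /anchored_measurable/= preimage_setC; exact: measurableC. Qed.

Let measurable_bigcup (F : (set anchored_space)^nat) :
  (forall i, anchored_measurable (F i)) -> anchored_measurable (\bigcup_i F i).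
Proof.
by move=> mF; rewrite /anchored_measurable/= preimage_bigcup; exact: bigcupT_measurable.
Qed.

HB.instance Definition _ := @isMeasurable.Build default_measure_display
  anchored_space anchored_measurable measurable0 measurableC measurable_bigcup.

Definition interval_part (A : set anchored_space) : \bar R :=
  m ((inr : Omega -> anchored_space) @^-1` A).

Definition anchored_measure (A : set anchored_space) : \bar R :=
  (interval_part A + \sum_(j < k) \d_(inl j : anchored_space) A)%E.

Let part0 : interval_part set0 = 0%E.
Proof. by rewrite /interval_part preimage_set0 measure0. Qed.

Let part_ge0 A : (0 <= interval_part A)%E.
Proof. exact: measure_ge0. Qed.

Let part_sigma_additive : semi_sigma_additive interval_part.
Proof.
move=> F mF tF mUF; rewrite /interval_part preimage_bigcup.
apply: measure_semi_sigma_additive => //.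
apply/trivIsetP => i j _ _ ij; rewrite -preimage_setI.
by move/trivIsetP : tF => /(_ i j Logic.I Logic.I ij) ->; rewrite preimage_set0.
Qed.

HB.instance Definition _ := isMeasure.Build _ anchored_space R interval_part
  part0 part_ge0 part_sigma_additive.

Let measureE : anchored_measure = measure_add interval_part
  (msum (fun n => oapp (fun j : 'I_k => [the measure _ _ of \d_(inl j : anchored_space)])
    [the measure _ _ of mzero] (insub n)) k).
Proof.
apply/funext => A; rewrite measure_addE /anchored_measure; congr (_ + _)%E.
by apply: eq_bigr => j _; rewrite valK.
Qed.

Let measure0 : anchored_measure set0 = 0%E.
Proof. by rewrite measureE /measure_add measure0. Qed.

Let measure_ge0 A : (0 <= anchored_measure A)%E.
Proof. by rewrite measureE /measure_add measure_ge0. Qed.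

Let measure_sigma_additive : semi_sigma_additive anchored_measure.
Proof. by rewrite measureE /measure_add; exact: measure_semi_sigma_additive. Qed.

HB.instance Definition _ := isMeasure.Build _ anchored_space R anchored_measure
  measure0 measure_ge0 measure_sigma_additive.

End anchored_space.
Arguments anchored_measure {R a b x0} x0ab k A.

Section complex_integral.
Context d (T : measurableType d) (R : realType).
Variable mu : {measure set T -> \bar R}.
Implicit Types f g : T -> R[i].

Definition cintegral f : R[i] :=
  (\int[mu]_t complex.Re (f t)) +i* (\int[mu]_t complex.Im (f t)).

Definition cintegrable f :=
  mu.-integrable [set: T] (fun t => (complex.Re (f t))%:E) /\
  mu.-integrable [set: T] (fun t => (complex.Im (f t))%:E).

Lemma cintegral_linear c f g : cintegrable f -> cintegrable g ->
  cintegral (fun t => c * f t + g t) = c * cintegral f + cintegral g.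
Proof.
move=> [fr fi] [gr gi]; rewrite /cintegral; case: c => cr ci /=.
have Z (z : R) (h : T -> R) : mu.-integrable setT (EFin \o h) ->
    mu.-integrable setT (EFin \o (fun t => z * h t)).
  move=> ih; rewrite (_ : _ \o _ = (fun t => z%:E * (h t)%:E)%E)//.
  exact: integrableZl.
have -> : (fun t => complex.Re ((cr +i* ci) * f t + g t)) =
    (fun t => (cr * complex.Re (f t) - ci * complex.Im (f t)) + complex.Re (g t)).
  by apply/funext => t; case: (f t) (g t) => [? ?] [? ?].
have -> : (fun t => complex.Im ((cr +i* ci) * f t + g t)) =
    (fun t => (cr * complex.Im (f t) + ci * complex.Re (f t)) + complex.Im (g t)).
  by apply/funext => t; case: (f t) (g t) => [? ?] [? ?].
have Zr := Z cr _ fr; have Zi := Z ci _ fi.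
have Zri := Z cr _ fi; have Zir := Z ci _ fr.
rewrite RintegralD//; last exact: (integrableB measurableT Zr Zi).
rewrite RintegralB// RintegralD//; last exact: (integrableD measurableT Zri Zir).
rewrite RintegralD// !RintegralZl//.
Qed.

Lemma ae_eq_cintegral f g : cmeasurable f -> cmeasurable g ->
  {ae mu, forall t, f t = g t} -> cintegral f = cintegral g.
Proof.
move=> [fr fi] [gr gi] fg; congr (_ +i* _); rewrite /Rintegral; congr fine;
  apply: ae_eq_integral => //; do ?exact/measurable_EFinP;
  by move: fg; apply: filterS => t ->.
Qed.

End complex_integral.

Definition test_function (R : realType) (a b : R) (phi : R -> R) :=
  [/\ forall n x, derivable (derive1n n phi) x 1,
      compact (closure [set x | phi x != 0]) &
      closure [set x | phi x != 0] `<=` [set` `]a, b[]].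

Section sobolev_space.
Context {R : realType} {a b x0 : R}.
Variables (x0ab : x0 \in `]a, b[) (p : \bar R) (p1 : (1 <= p)%E) (k : nat).
Local Notation Omega := (interval_space x0ab).
Local Notation m := (interval_measure x0ab).
Local Notation LpOmega := (Lp m p1).

(* Real test functions suffice for complex u and v, by linearity. *)
Definition weak_derivative (j : nat) (u v : Omega -> R[i]) :=
  forall phi, test_function a b phi ->
    cintegral m (fun t : Omega => u t * (derive1n j phi (t : R))%:C) =
    (-1) ^+ j * cintegral m (fun t : Omega => v t * (phi t)%:C).

Lemma interval_measure_fin : (m [set: Omega] < +oo)%E.
Proof.
rewrite /interval_measure (@image_interval_val _ _ _ _ _ _ setT)// setTI.
have : (lebesgue_measure ([set` `]a, b[] : set R) < +oo)%E.
  by rewrite lebesgue_measure_itv; case: ifP => _; rewrite ?ltry// -EFinB ltry.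
by [].
Qed.

Lemma measurable_interval_val (f : R -> R) :
  measurable_fun [set: R] f -> measurable_fun [set: Omega] (fun t : Omega => f (t : R)).
Proof.
move=> mf _ B mB; rewrite setTI.
rewrite /measurable/= /interval_measurable/= (@image_interval_val _ _ _ _ _ _ (f @^-1` B))//.
apply: measurableI; last exact: lebesgue_measurable_itv.
by apply: sub_caratheodory; rewrite -[X in _ X]setTI; exact: mf.
Qed.

Lemma test_function_bounded phi n : test_function a b phi ->
  exists M : R, forall t : Omega, `|(derive1n n phi) (t : R)| <= M.
Proof.
case=> dphi _ _.
have cphi : {within `[a, b], continuous (derive1n n phi)}.
  apply: continuous_subspaceT => x.
  exact/differentiable_continuous/derivable1_diffP.
have [M [_ HM]] := compact_bounded (continuous_compact cphi (segment_compact (a := a) (b := b))).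
exists (M + 1) => t; apply: (HM (M + 1)); first by rewrite ltrDl.
exists (t : R) => //=; have := svalP t.
by rewrite !in_itv/= => /andP[/ltW -> /ltW ->].
Qed.

Lemma measurable_derive1n phi n : test_function a b phi ->
  measurable_fun [set: Omega] (fun t : Omega => (derive1n n phi) (t : R)).
Proof.
case=> dphi _ _; apply: measurable_interval_val; apply: continuous_measurable_fun => x.
exact/differentiable_continuous/derivable1_diffP.
Qed.

Lemma cmeasurableMr (u : Omega -> R[i]) (h : Omega -> R) : cmeasurable u ->
  measurable_fun setT h -> cmeasurable (fun t : Omega => u t * (h t)%:C).
Proof.
move=> [ur ui] mh; split.
  rewrite (_ : (fun t => _) = (fun t => complex.Re (u t) * h t)).
    exact: measurable_funM.
  by apply/funext => t; case: (u t) => ? ? /=; rewrite mulr0 subr0.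
rewrite (_ : (fun t => _) = (fun t => complex.Im (u t) * h t)).
  exact: measurable_funM.
by apply/funext => t; case: (u t) => ? ? /=; rewrite mulr0 add0r.
Qed.

Lemma Lp_test_cintegrable (u : LpOmega) phi n : test_function a b phi ->
  cintegrable m (fun t : Omega => u t * (derive1n n phi (t : R))%:C).
Proof.
move=> tphi; have [M HM] := test_function_bounded n tphi.
have mphi := measurable_derive1n n tphi.
have [mu lu] := LpP u; have mnu := measurable_normc mu.
have Lu : (@normc R \o u) \in Lfun m p by apply/andP; split; exact: mem_set.
have fin : m [set: Omega] \is a fin_num.
  by rewrite ge0_fin_numE ?interval_measure_fin.
have := Lfun_subset (lexx 1%E) p1 fin p1 Lu.
move/Lfun1_integrable => iu.
have iMu : m.-integrable setT (fun t => (M * normc (u t))%:E).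
  rewrite (_ : (fun t => _) = (fun t => M%:E * (normc (u t))%:E)%E)//.
  exact: integrableZl.
have [mr mi] := cmeasurableMr mu mphi.
have bnd (z : R[i]) (h : R) : `|h| <= M ->
    `|complex.Re (z * h%:C)| <= M * normc z /\ `|complex.Im (z * h%:C)| <= M * normc z.
  case: z => x y hM /=; rewrite !mulr0 subr0 add0r !normrM ![_ * `|h|]mulrC.
  have xy : `|x| <= Num.sqrt (x ^+ 2 + y ^+ 2) /\ `|y| <= Num.sqrt (x ^+ 2 + y ^+ 2).
    by split; rewrite -sqrtr_sqr ler_sqrt ?addr_ge0 ?sqr_ge0// ?lerDl ?lerDr sqr_ge0.
  by split; apply: ler_pM => //; case: xy.
split.
  apply: (le_integrable measurableT _ _ iMu).
    exact/measurable_EFinP.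
  move=> t _; rewrite !abse_EFin lee_fin; apply: (le_trans _ (ler_norm _)).
  by have [] := bnd (u t) _ (HM t).
apply: (le_integrable measurableT _ _ iMu).
  exact/measurable_EFinP.
move=> t _; rewrite !abse_EFin lee_fin; apply: (le_trans _ (ler_norm _)).
by have [] := bnd (u t) _ (HM t).
Qed.

Lemma weak_derivative_linear j c (u v u' v' : LpOmega) :
  weak_derivative j u u' -> weak_derivative j v v' ->
  weak_derivative j (Lp_repr (c *: u + v)) (Lp_repr (c *: u' + v')).
Proof.
move=> du dv phi tphi.
have E (x y : LpOmega) n :
    cintegral m (fun t : Omega => Lp_repr (c *: x + y) t * (derive1n n phi (t : R))%:C) =
    c * cintegral m (fun t : Omega => x t * (derive1n n phi (t : R))%:C) +
    cintegral m (fun t : Omega => y t * (derive1n n phi (t : R))%:C).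
  rewrite -cintegral_linear; [|exact: Lp_test_cintegrable..].
  have mphi := measurable_derive1n n tphi.
  have [mx _] := LpP x; have [my _] := LpP y.
  apply: ae_eq_cintegral.
  - exact: (cmeasurableMr (proj1 (LpP (c *: x + y))) mphi).
  - exact: (cmeasurableD (cmeasurableZ c (cmeasurableMr mx mphi)) (cmeasurableMr my mphi)).
  - have := ae_Lp_linear c x y; apply: filterS => t ->.
    by rewrite mulrDl mulrA.
have E0 := E _ _ 0%N; rewrite /= in E0.
by rewrite E (E0 u' v') (du _ tphi) (dv _ tphi) mulrDr mulrCA.
Qed.

Definition sobolev : {pred LpOmega} :=
  mem [set u : LpOmega | forall j, (0 < j <= k)%N ->
    exists v : LpOmega, weak_derivative j u v].

Lemma sobolev_submod_closed : submod_closed sobolev.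
Proof.
split.
  rewrite inE => j _; exists 0 => phi tphi.
  have Z n : cintegral m (fun t : Omega => (0 : LpOmega) t * (derive1n n phi (t : R))%:C) = 0.
    rewrite (_ : cintegral _ _ = cintegral m (fun=> 0)).
      by rewrite /cintegral /= !Rintegral_cst// !mul0r.
    apply: ae_eq_cintegral.
    - exact: (cmeasurableMr (proj1 (LpP (0 : LpOmega))) (measurable_derive1n n tphi)).
    - exact: cmeasurable0.
    - by have := @ae_Lp0 _ _ _ m p p1; apply: filterS => t ->; rewrite mul0r.
  by rewrite Z (Z 0%N) mulr0.
move=> c u v; rewrite !inE => du dv j jk.
have [u' uu'] := du _ jk; have [v' vv'] := dv _ jk.
by exists (c *: u' + v'); exact: weak_derivative_linear.
Qed.

HB.instance Definition _ := GRing.isSubmodClosed.Build _ _ sobolev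
  sobolev_submod_closed.

Record sobolev_space := SobolevFun
  { sobolev_fun :> LpOmega ; _ : sobolev_fun \in sobolev }.
HB.instance Definition _ := [isSub for sobolev_fun].
HB.instance Definition _ := [Choice of sobolev_space by <:].
HB.instance Definition _ := [SubChoice_isSubLmodule of sobolev_space by <:].

(* The weak derivative is unique as an element of Lp, so xget selects it. *)
Definition sobolev_derivative (j : nat) (f : sobolev_space) : LpOmega :=
  if j == 0%N then f : LpOmega
  else xget 0 [set v : LpOmega | weak_derivative j (f : LpOmega) v].

Definition absolutely_continuous (u : Omega -> R[i]) :=
  forall e : R, 0 < e -> exists2 d : R, 0 < d &
    forall n (s t : 'I_n -> Omega),
      (forall i, (s i : R) <= (t i : R)) ->
      (forall i j, i != j -> (t i : R) <= (s j : R) \/ (t j : R) <= (s i : R)) ->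
      \sum_i ((t i : R) - (s i : R)) < d -> \sum_i normc (u (t i) - u (s i)) < e.

(* Two continuous functions that are a.e. equal coincide, so xget selects the
   absolutely continuous representative when there is one, in particular for the
   derivatives of order less than k of a function in the Sobolev space. *)
Definition ac_representative (v : LpOmega) : Omega -> R[i] :=
  xget (v : Omega -> R[i])
    [set u | absolutely_continuous u /\ {ae m, forall t, u t = v t}].

Definition anchor_value (j : nat) (f : sobolev_space) : R[i] :=
  ac_representative (sobolev_derivative j f) (base_point x0ab).

(* Only p = r%:E and p = +oo occur, since 1 <= p. *)
Definition sobolev_norm (f : sobolev_space) : R :=
  if p is r%:E then
    (\sum_(j < k) normc (anchor_value j f) `^ r +
      Lp_norm m p1 (sobolev_derivative k f) `^ r) `^ r^-1
  else
    Num.max (\big[Num.max/0]_(j < k) normc (anchor_value j f))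
      (Lp_norm m p1 (sobolev_derivative k f)).

Definition sobolev_cone : set sobolev_space :=
  [set f : sobolev_space | [/\ {ae m, forall t, complex.Im (Lp_repr f t) = 0},
    {ae m, forall t, 0 <= sobolev_derivative k f t} &
    forall j, (j < k)%N -> 0 <= anchor_value j f]].

End sobolev_space.
Arguments sobolev_norm {R a b x0} x0ab {p} p1 k f.
Arguments sobolev_cone {R a b x0} x0ab {p} p1 k.

Definition isometric_order_isomorphism (R : realType) (E F : lmodType R[i])
    (normE : E -> R) (coneE : set E) (normF : F -> R) (coneF : set F)
    (Phi : {linear E -> F}) : Prop :=
  [/\ set_surj setT setT Phi,
      forall f, normF (Phi f) = normE f,
      Phi @` coneE = coneF &
      Phi @^-1` coneF = coneE].

(* Main.v *)
From HB Require Import structures.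
Require Import Defs.
From mathcomp Require Import all_boot all_order all_algebra.
From mathcomp Require Import complex.
From mathcomp Require Import all_classical all_reals all_analysis.
From mathcomp Require Import measurable_realfun ess_sup_inf hoelder.
From mathcomp Require Import ring lra.

(** The isomorphism sends [f] to the function on the enlarged space whose value
    at the [j]-th atom is [f^(j)(x0)] and whose restriction to the interval is
    [f^(k)].  Both norms are then the same expression, and the two cones differ
    only by the requirement that [f] be real, so what has to be proved is that
    this map is well defined, linear and onto, and that [f] is real as soon as
    its data are.

    All this rests on Taylor's formula of order one for weak derivatives: for
    [j < k], almost everywhere
      [f^(j)(x) = f^(j)(x0) + \int_x0^x f^(j+1)],
    the right-hand side being absolutely continuous ([sobolev_taylor]).  In one
    direction the primitive of an integrable [v] has weak derivative [v]: this
    is Fubini's theorem ([primitive_by_parts]).  In the other direction, the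
    difference of [f^(j)] and of the primitive of [f^(j+1)] has zero weak
    derivative, hence is constant ([du_bois_reymond]).  Uniqueness of weak
    derivatives, which gives linearity, is [fundamental_lemma]: the functions
    [smooth_bump c d n] are test functions converging boundedly to the indicator
    of [`]c, d[], so a function orthogonal to all test functions has zero
    integral over all intervals, hence over all Borel sets by Dynkin's theorem,
    hence over all Lebesgue measurable sets, which are Borel up to null sets.

    Surjectivity comes from integrating [k] times, inserting the prescribed
    values at [x0] as integration constants ([sobolev_surjective]), and the
    reality of [f] from Taylor's formula by descending induction on the order of
    the derivative ([sobolev_real]). *)

Import Order.TTheory GRing.Theory Num.Theory.
Import numFieldNormedType.Exports.
Local Open Scope classical_set_scope.
Local Open Scope ring_scope.

(** * Smooth functions and a flat function *)

(** Smoothness on the whole line, in the form in which it occurs in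
    [test_function]. *)
Definition smooth {R : realType} (f : R -> R) : Prop :=
  forall n x, derivable (derive1n n f) x 1.

Lemma smooth_derive1 {R : realType} (f : R -> R) : smooth f -> smooth (derive1 f).
Proof. by move=> sf n x; rewrite -derive1Sn; exact: sf. Qed.

(** A class of differentiable functions stable under differentiation consists
    of smooth functions. *)
Lemma smooth_family {R : realType} (P : (R -> R) -> Prop) :
  (forall f, P f -> (forall x, derivable f x 1) /\ P (derive1 f)) ->
  forall f, P f -> smooth f.
Proof.
move=> HP f Pf n; suff [] : (forall x, derivable (derive1n n f) x 1) /\
  P (derive1n n f) by [].
elim: n => [|n IH]; first by split; [exact: (HP f Pf).1|].
by split; [exact: (HP _ (HP _ IH.2).2).1|exact: (HP _ IH.2).2].
Qed.

Lemma smooth_primitive {R : realType} (f : R -> R) :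
  (forall x, derivable f x 1) -> smooth (derive1 f) -> smooth f.
Proof. by move=> df sf [|n] x; [exact: df|rewrite derive1Sn; exact: sf]. Qed.

Lemma smooth_continuous {R : realType} (f : R -> R) n : smooth f ->
  continuous (derive1n n f).
Proof.
by move=> sf x; exact/differentiable_continuous/derivable1_diffP/sf.
Qed.

Lemma smooth_cst {R : realType} (c : R) : smooth (cst c).
Proof.
apply: (@smooth_family R (fun f => exists c, f = cst c)); last by exists c.
move=> _ [d ->]; split => [x|]; first exact: derivable_cst.
by exists 0; apply/funext => x; rewrite derive1_cst.
Qed.

(** The functions built from smooth ones by sums, products and affine changes
    of variable.  The derivative of such an expression is again one, so that
    [smooth_family] applies to all three operations at once. *)
Inductive smooth_expression {R : realType} : (R -> R) -> Prop :=
| SmoothBase f : smooth f -> smooth_expression f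
| SmoothAdd f g : smooth_expression f -> smooth_expression g ->
    smooth_expression (f \+ g)
| SmoothMul f g : smooth_expression f -> smooth_expression g ->
    smooth_expression (f \* g)
| SmoothAffine f c d : smooth_expression f ->
    smooth_expression (fun x => f (c * x + d)).

Lemma smooth_expressionP {R : realType} (f : R -> R) :
  smooth_expression f -> smooth f.
Proof.
move: f; apply: smooth_family => f; elim => {f}.
- move=> f sf; split; first exact: (sf 0%N).
  exact/SmoothBase/smooth_derive1.
- move=> f g _ [df Ef] _ [dg Eg]; split => [x|]; first exact: derivableD.
  rewrite (_ : derive1 _ = derive1 f \+ derive1 g); first exact: SmoothAdd.
  by apply/funext => x /=; rewrite !derive1E deriveD.
- move=> f g sf [df Ef] sg [dg Eg]; split => [x|]; first exact: derivableM.
  rewrite (_ : derive1 _ = (f \* derive1 g) \+ (g \* derive1 f)).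
    by apply: SmoothAdd; exact: SmoothMul.
  by apply/funext => x /=; rewrite !derive1E deriveM.
- move=> f c d sf [df Ef].
  have da (x : R) : is_derive x 1 (fun x : R => c * x + d) c.
    have h := is_deriveD (is_deriveZ c (is_derive_id x 1)) (is_derive_cst d x 1).
    by apply: (is_derive_eq h); rewrite addr0 /GRing.scale/= mulr1.
  have dfa (x : R) : is_derive x 1 (fun x : R => f (c * x + d)) (derive1 f (c * x + d) * c).
    apply: (@is_derive1_comp R f (fun x => c * x + d)).
    by rewrite derive1E; apply: derivableP; exact: df.
  split => [x|]; first exact: (@ex_derive _ _ _ _ _ _ _ (dfa x)).
  rewrite (_ : derive1 _ = (fun x => derive1 f (c * x + d)) \* cst c).
    by apply: SmoothMul; [exact: SmoothAffine|exact/SmoothBase/smooth_cst].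
  by apply/funext => x /=; rewrite derive1E (@derive_val _ _ _ _ _ _ _ (dfa x)).
Qed.

(** The function [p(1/x) exp(-1/x)] extended by [0] to the nonpositive reals.
    The polynomial factor makes the class stable under differentiation. *)
Definition flat_exp {R : realType} (p : {poly R}) (x : R) : R :=
  if 0 < x then p.[x^-1] * expR (- x^-1) else 0.

(** With [y = 1/x >= 1] and [n = size p], [|p(y)| <= A y^n] while
    [exp(y) >= y^(n+2) / (n+2)!].  The resulting quadratic bound gives the
    derivative at [0]. *)
Lemma flat_exp_bound {R : realType} (p : {poly R}) :
  exists2 C : R, 0 < C & forall x, `|x| <= 1 -> `|flat_exp p x| <= C * x ^+ 2.
Proof.
pose n := size p; pose A : R := \sum_(i < n) `|p`_i|.
have A0 : 0 <= A by apply: sumr_ge0.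
exists ((A + 1) * (n.+2)`!%:R).
  by rewrite mulr_gt0 ?ltr0n ?fact_gt0// ltr_wpDl.
move=> x x1; rewrite /flat_exp; case: ifPn => x0; last first.
  by rewrite normr0 mulr_ge0// ?sqr_ge0// mulr_ge0 ?ler0n// addr_ge0.
have y1 : 1 <= x^-1 by rewrite invf_ge1// (le_trans (ler_norm _)).
set y := x^-1 in y1 *.
have y0 : 0 < y by apply: lt_le_trans y1.
have py : `|p.[y]| <= A * y ^+ n.
  rewrite horner_coef mulr_suml (le_trans (ler_norm_sum _ _ _))//.
  apply: ler_sum => i _; rewrite normrM ler_wpM2l// normrX gtr0_norm//.
  by rewrite ler_weXn2l// ltnW.
have ey : y ^+ n.+2 / (n.+2)`!%:R <= expR y.
  by rewrite (le_trans _ (expR_ge1Dxn n.+1 (ltW y0)))// lerDr.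
rewrite normrM (gtr0_norm (expR_gt0 _)) expRN.
rewrite ler_pdivrMr ?expR_gt0//.
have f0 : 0 < (n.+2)`!%:R :> R by rewrite ltr0n fact_gt0.
apply: (le_trans py).
rewrite ler_pdivrMr// in ey.
have xE : x ^+ 2 = (y ^+ 2)^-1 by rewrite /y exprVn invrK.
have yy : 0 <= y ^- 2 by rewrite invr_ge0 sqr_ge0.
have -> : A * y ^+ n = A * y ^+ n.+2 * y ^- 2.
  by rewrite -mulrA -addn2 exprD mulfK// expf_eq0/= gt_eqF.
rewrite xE.
have -> : (A + 1) * (n.+2)`!%:R * y ^- 2 * expR y =
    (A + 1) * (expR y * (n.+2)`!%:R) * y ^- 2.
  by rewrite [expR y * _]mulrC mulrA mulrAC.
apply: ler_wpM2r => //; apply: ler_pM => //; first by rewrite exprn_ge0// ltW.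
by rewrite lerDl.
Qed.

Lemma is_derive_flat_exp {R : realType} (p : {poly R}) (x : R) :
  is_derive x 1 (flat_exp p) (flat_exp ('X^2 * (p - p^`())) x).
Proof.
have [x0|x0|x0] := ltgtP x 0.
- rewrite [X in is_derive _ _ _ X](_ : _ = 0); last first.
    by rewrite /flat_exp ltNge (ltW x0).
  apply: (@near_eq_is_derive _ _ _ (cst 0)).
  near=> z; rewrite /flat_exp ltNge (_ : z <= 0)//.
  by near: z; exact: lt_le_nbhsl.
- pose h (z : R) := p.[z^-1] * expR (- z^-1).
  apply: (@near_eq_is_derive _ _ _ h).
    near=> z; rewrite /flat_exp (_ : 0 < z)//.
    by near: z; exact: lt_nbhsr.
  rewrite /flat_exp x0.
  have dV : is_derive x 1 (fun z : R => z^-1) (- x ^- 2).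
    apply: DeriveDef; first by apply: derivableV; rewrite ?gt_eqF.
    by rewrite (@deriveV _ _ id) ?gt_eqF// derive_id /GRing.scale/= mulr1.
  have dVN : is_derive x 1 (fun z : R => - z^-1) (x ^- 2).
    by rewrite -[x ^- 2]opprK; exact: is_deriveN.
  have d1 := @is_derive1_comp R (horner p) _ x _ _ (is_derive_poly p _) dV.
  have d2 := @is_derive1_comp R expR _ x _ _ (is_derive_expR _) dVN.
  have d3 : is_derive x 1 h _ := is_deriveM d1 d2.
  apply: (is_derive_eq d3).
  rewrite /GRing.scale/= hornerM hornerXn hornerD hornerN.
  rewrite exprVn; ring.
rewrite x0 /flat_exp ltxx.
have [C C0 HC] := flat_exp_bound p.
(* The difference quotient at 0 is bounded by C |h|. *)
have cv : (fun h : R => h^-1 *: ((flat_exp p \o shift 0) (h *: 1) - flat_exp p 0))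
    @ 0^' --> (0 : R).
  apply/cvgr0Pnorm_lt => e e0; near=> h.
  rewrite /= addr0 /GRing.scale/= mulr1 {2}/flat_exp ltxx subr0.
  have h1 : `|h| <= 1.
    near: h; apply: dnbhs0_le; exact: ltr01.
  rewrite normrM normfV.
  have h0 : h != 0 by near: h; exact: nbhs_dnbhs_neq.
  rewrite ltr_pdivrMl ?normr_gt0//.
  apply: (le_lt_trans (HC _ h1)).
  rewrite -real_normK ?num_real// expr2 mulrA mulrC ltr_pM2l ?normr_gt0//.
  rewrite mulrC -ltr_pdivlMr//.
  by near: h; apply: dnbhs0_lt; rewrite divr_gt0.
apply: DeriveDef; first by apply/cvg_ex; exists 0.
exact: (cvg_lim _ cv).
Unshelve. all: by end_near. Qed.

Lemma smooth_flat_exp {R : realType} (p : {poly R}) : smooth (flat_exp p).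
Proof.
apply: (@smooth_family R (fun f => exists p, f = flat_exp p)); last by exists p.
move=> _ [q ->]; split => [x|].
  exact: (@ex_derive _ _ _ _ _ _ _ (is_derive_flat_exp q x)).
exists ('X^2 * (q - q^`())); apply/funext => x.
by rewrite derive1E (@derive_val _ _ _ _ _ _ _ (is_derive_flat_exp q x)).
Qed.

(** * Test functions *)

Lemma smooth_linear {R : realType} (f g : R -> R) (c d : R) : smooth f -> smooth g ->
  smooth (fun x => c * f x + d * g x).
Proof.
move=> sf sg; pose cst_mul k h (sh : smooth h) :=
  SmoothMul _ _ (SmoothBase _ (@smooth_cst R k)) (SmoothBase _ sh).
exact (smooth_expressionP _ (SmoothAdd _ _ (cst_mul c f sf) (cst_mul d g sg))).
Qed.

Lemma smooth_test_function {R : realType} (a b c d : R) (f : R -> R) :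
  a < c -> d < b -> smooth f -> (forall x, f x != 0 -> c <= x <= d) ->
  test_function a b f.
Proof.
move=> ac db sf fcd.
have sub : closure [set x | f x != 0] `<=` [set` `[c, d]].
  rewrite [X in _ `<=` X](closure_id _).1; last exact: itv_closed.
  by apply: closure_subset => x /= /fcd; rewrite in_itv.
split => //.
  apply: (subclosed_compact _ (@segment_compact R c d)) => //.
  exact: closed_closure.
by move=> x /sub /=; rewrite !in_itv/= => /andP[cx xd]; apply/andP; split; lra.
Qed.

(** The support of a test function, being compact in the open interval, stays
    away from the endpoints. *)
Lemma test_function_support {R : realType} (a b : R) (f : R -> R) : a < b ->
  test_function a b f -> exists c d, [/\ a < c, c <= d, d < b &
    forall x, f x != 0 -> c <= x <= d].
Proof.
move=> ab [sf cf fab].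
have [[y Ky]|K0] := pselect (exists y, closure [set x | f x != 0] y); last first.
  exists ((a + b) / 2), ((a + b) / 2); split => //; [lra|lra|].
  by move=> x fx; exfalso; apply: K0; exists x; exact: subset_closure.
have Kne : closure [set x | f x != 0] !=set0 by exists y.
have cid (A : set R) : {within A, continuous (@id R)} by apply: continuous_subspaceT => x; exact: cvg_id.
have cN (A : set R) : {within A, continuous (@GRing.opp R)}.
  by apply: continuous_subspaceT; exact: opp_continuous.
have [d Kd Hd] := compact_EVT_max Kne cf (cid _).
have [c Kc Hc] := compact_EVT_max Kne cf (cN _).
have H x : closure [set x | f x != 0] x -> c <= x <= d.
  by move=> Kx; rewrite Hd ?inE// andbT -lerN2 Hc ?inE.
have /fab := set_mem Kc; have /fab := set_mem Kd.
rewrite /= !in_itv/= => /andP[_ db] /andP[ac _].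
exists c, d; split => //.
  by have /andP[] := H _ Ky; exact: le_trans.
by move=> x fx; apply: H; exact: subset_closure.
Qed.

Lemma test_function_linear {R : realType} (a b c d : R) (f g : R -> R) : a < b ->
  test_function a b f -> test_function a b g ->
  test_function a b (fun x => c * f x + d * g x).
Proof.
move=> ab tf tg.
have [c1 [d1 [ac1 cd1 db1 H1]]] := test_function_support _ _ _ ab tf.
have [c2 [d2 [ac2 cd2 db2 H2]]] := test_function_support _ _ _ ab tg.
case: tf tg => [sf _ _] [sg _ _].
apply: (@smooth_test_function R a b (Num.min c1 c2) (Num.max d1 d2)).
- by rewrite lt_min ac1.
- by rewrite gt_max db1.
- exact (smooth_linear _ _ c d sf sg).
- move=> x fgx; rewrite ge_min le_max.
  have [fx0|/H1/andP[-> ->]//] := eqVneq (f x) 0.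
  have [gx0|/H2/andP[-> ->]//] := eqVneq (g x) 0; last by rewrite !orbT.
  by rewrite fx0 gx0 !mulr0 addr0 eqxx in fgx.
Qed.

Lemma test_function_derive {R : realType} (a b : R) n (f : R -> R) : a < b ->
  test_function a b f -> test_function a b (derive1n n f).
Proof.
move=> ab tf; elim: n => // n IH.
have [c [d [ac cd db H]]] := test_function_support _ _ _ ab IH.
apply: (smooth_test_function a b c d) => //.
  by rewrite derive1nS; apply: smooth_derive1; case: IH.
move=> x; apply: contraNT; rewrite negb_and -!ltNge derive1nS => xcd.
suff : is_derive x 1 (derive1n n f) 0.
  by move=> dx; rewrite derive1E (@derive_val _ _ _ _ _ _ _ dx).
apply: (@near_eq_is_derive _ _ _ (cst 0)).
have Z y : (y < c) || (d < y) -> derive1n n f y = 0.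
  by move=> ycd; apply/eqP; apply: contraLR ycd => /H/andP[cy yd];
    rewrite negb_or -!leNgt cy.
case/orP: xcd => xcd; near=> y; rewrite Z//; apply/orP.
  by left; near: y; exact: lt_nbhsl.
by right; near: y; exact: lt_nbhsr.
Unshelve. all: by end_near. Qed.

Lemma test_function_out {R : realType} (a b x : R) (f : R -> R) : a < b ->
  test_function a b f -> (x <= a) || (b <= x) -> f x = 0.
Proof.
move=> ab [_ _ H] xab; apply/eqP; apply: contraLR xab => fx.
have /= := H x (@subset_closure _ [set x | f x != 0] _ fx).
by rewrite in_itv/= negb_or -!ltNge.
Qed.

(** A smooth function with values between [0] and [1], vanishing outside
    the closed interval from [c + 1/(n+1)] to [d - 1/(n+1)]. *)
Definition smooth_bump {R : realType} (c d : R) (n : nat) (x : R) : R :=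
  flat_exp 1 (n.+1%:R * (x - c) - 1) * flat_exp 1 (n.+1%:R * (d - x) - 1).

Lemma flat_exp1_itv {R : realType} (x : R) : 0 <= flat_exp 1 x <= 1.
Proof.
rewrite /flat_exp; case: ifPn => x0; last by rewrite lexx ler01.
by rewrite hornerC mul1r expR_ge0/= expR_le1 oppr_le0 invr_ge0 ltW.
Qed.

Lemma bump_itv {R : realType} (c d : R) n x : 0 <= smooth_bump c d n x <= 1.
Proof.
have /andP[p0 p1] := flat_exp1_itv (n.+1%:R * (x - c) - 1).
have /andP[q0 q1] := flat_exp1_itv (n.+1%:R * (d - x) - 1).
by rewrite /smooth_bump mulr_ge0//= mulr_ile1.
Qed.

Lemma test_function_bump {R : realType} (a b c d : R) n : a <= c -> d <= b ->
  test_function a b (smooth_bump c d n).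
Proof.
move=> ac db; have n0 : 0 < n.+1%:R :> R by rewrite ltr0n.
apply: (@smooth_test_function R a b (c + n.+1%:R^-1) (d - n.+1%:R^-1)).
- by rewrite (le_lt_trans ac)// ltrDl invr_gt0.
- by rewrite (lt_le_trans _ db)// gtrDl oppr_lt0 invr_gt0.
- apply: smooth_expressionP.
  rewrite (_ : smooth_bump _ _ _ = (fun x => flat_exp 1 (n.+1%:R * x + (- n.+1%:R * c - 1))) \*
    (fun x => flat_exp 1 (- n.+1%:R * x + (n.+1%:R * d - 1)))).
    apply: SmoothMul; apply: (SmoothAffine (flat_exp 1)); exact/SmoothBase/smooth_flat_exp.
  apply/funext => x; rewrite /smooth_bump/=; congr (flat_exp _ _ * flat_exp _ _).
    by rewrite mulrBr mulNr addrA.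
  by rewrite mulrBr mulNr addrA [- _ + _]addrC.
- move=> x; apply: contraNT; rewrite negb_and -!ltNge => xcd; apply/eqP.
  have Z z : z <= 0 -> flat_exp (1 : {poly R}) z = 0 by rewrite /flat_exp leNgt; case: ltP.
  have nV : n.+1%:R * n.+1%:R^-1 = 1 :> R by rewrite divff// gt_eqF.
  rewrite /smooth_bump; case/orP: xcd => xcd.
    rewrite Z ?mul0r// subr_le0 -[leRHS]nV ler_pM2l// ltW// ltrBlDl//.
  by rewrite [X in _ * X]Z ?mulr0// subr_le0 -[leRHS]nV ler_pM2l// ltW// ltrBlDl -ltrBlDr.
Qed.

Lemma cvg_flat_exp_natmul {R : realType} (z : R) : 0 < z ->
  (fun n => flat_exp 1 (n.+1%:R * z - 1)) @ \oo --> (1 : R).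
Proof.
move=> z0.
pose u (n : nat) : R := n.+1%:R * z - 1.
have ucv : u @ \oo --> +oo.
  apply/cvgryPge => A.
  near=> n; rewrite /u lerBrDr -ler_pdivrMr//.
  apply: (@le_trans _ _ n%:R); last by rewrite ler_nat.
  by near: n; exact: nbhs_infty_ger.
have uV : (fun n => expR (- (u n)^-1)) @ \oo --> (1 : R).
  rewrite -[X in _ --> X](@expR0 R).
  apply: continuous_cvg; first exact: continuous_expR.
  rewrite -[X in _ --> X]oppr0; apply: cvgN.
  apply/gtr0_cvgV0 => //.
  by move/cvgryPgt : ucv; exact.
apply: cvg_trans uV; apply: near_eq_cvg.
near=> n; rewrite /flat_exp -/(u n) ifT; first by rewrite hornerC mul1r.
by near: n; move/cvgryPgt : ucv; exact.
Unshelve. all: by end_near. Qed.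

Lemma cvg_bump {R : realType} (c d x : R) :
  smooth_bump c d n x @[n --> \oo] --> (\1_(`]c, d[%classic : set R) x : R).
Proof.
rewrite indicE; have [|] := boolP (x \in _).
  rewrite inE/= in_itv/= => /andP[cx xd].
  rewrite -[X in _ --> X](mulr1 1).
  by apply: cvgM; apply: cvg_flat_exp_natmul; rewrite subr_gt0.
move=> /negP; rewrite inE/= in_itv/= => /negP xcd.
rewrite (_ : (fun n => _) = cst 0); first exact: cvg_cst.
apply/funext => n; apply/eqP; apply: contraNT xcd => bx.
have [_ _ H] := test_function_bump c d c d n (lexx _) (lexx _).
by have := H x (@subset_closure _ [set x | smooth_bump c d n x != 0] _ bx); rewrite /= in_itv.
Qed.

(** * Lebesgue measure on the interval *)

HB.instance Definition _ (R : realType) (a b x0 : R) (x0ab : x0 \in `]a, b[) :=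
  Measure_isFinite.Build _ _ _ (interval_measure x0ab)
    (lty_fin_num_fun (interval_measure_fin x0ab)).

Section interval_measure_theory.
Context {R : realType} {a b x0 : R} (x0ab : x0 \in `]a, b[).
Local Notation Omega := (interval_space x0ab).
Local Notation m := (interval_measure x0ab).
Local Notation val := (@interval_val R a b x0 x0ab).

Lemma interval_lt : a < b.
Proof. by move: x0ab; rewrite in_itv/= => /andP[ax xb]; exact: lt_trans xb. Qed.

Lemma interval_val_itv (t : Omega) : a < val t < b.
Proof. by have := svalP t; rewrite in_itv. Qed.

Lemma measurable_val : measurable_fun setT (val : Omega -> R).
Proof. exact: (measurable_interval_val (@measurable_id _ R setT)). Qed.

Lemma measurable_val_preimage (B : set R) : measurable B -> measurable (val @^-1` B).
Proof. by move=> mB; rewrite -[X in measurable X]setTI; exact: measurable_val. Qed.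

Lemma interval_measure_preimage (B : set R) : 
  m (val @^-1` B) = lebesgue_measure (B `&` [set` `]a, b[]).
Proof. by rewrite /interval_measure (image_interval_val (B := B)). Qed.

Lemma interval_integral_preimage (f : R -> R) (D : set R) : measurable D ->
  D `<=` [set` `]a, b[] -> measurable_fun setT f ->
  m.-integrable (val @^-1` D) (EFin \o (f \o val)) ->
  (\int[m]_(t in val @^-1` D) (f (val t))%:E = \int[lebesgue_measure]_(x in D) (f x)%:E)%E.
Proof.
move=> mD Dab mf fi.
have mv : measurable_fun setT (val : Omega -> measurableTypeR R) := measurable_val.
have mEf : measurable_fun setT (EFin \o f : measurableTypeR R -> \bar R).
  exact/measurable_EFinP.
rewrite -(integral_pushforward mv mEf fi mD).
apply: (@eq_measure_integral _ (measurableTypeR R) R D lebesgue_measure) => A mA AD.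
transitivity (lebesgue_measure (A `&` [set` `]a, b[])).
  exact: interval_measure_preimage.
by rewrite setIidl//; exact: subset_trans Dab.
Qed.

End interval_measure_theory.

(** * The fundamental lemma of the calculus of variations *)

Section fundamental_lemma.
Context {R : realType} {a b x0 : R} (x0ab : x0 \in `]a, b[).
Local Notation Omega := (interval_space x0ab).
Local Notation m := (interval_measure x0ab).
Local Notation val := (@interval_val R a b x0 x0ab).

(** Up to a null set, a Lebesgue measurable set is a Borel set. *)
Lemma interval_measurable_borel (E : set Omega) : measurable E ->
  exists B M : set R, [/\ measurable B, measurable M, m (val @^-1` M) = 0 &
    E `\` (val @^-1` M) = val @^-1` (B `\` M)].
Proof.
move=> mE; have : lebesgue_measurable (val @` E) by exact: mE.
rewrite /lebesgue_measurable -completed_caratheodory_measurable.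
rewrite g_sigma_completed_algebra_genE => -[B mB [N [M [mM M0 NM]] BNE]].
exists B, M; split => //.
  apply/eqP; rewrite eq_le measure_ge0 andbT.
  rewrite (interval_measure_preimage x0ab M) -M0 le_measure// ?inE//.
  exact: measurableI.
apply/seteqP; split => t /=.
  move=> [Et Mt]; split => //.
  have : (B `|` N) (val t) by rewrite BNE; exists t.
  by case=> // /NM.
move=> [Bt Mt]; split => //.
have : (val @` E) (val t) by rewrite -BNE; left.
by move=> [s Es /interval_val_inj <-].
Qed.

(** The Borel sets over which [v] has zero integral form a Dynkin class
    containing the open intervals; null sets do not contribute, so that [v] has
    zero integral over every measurable set. *)
Lemma ae_eq0_of_itv (v : Omega -> R) : m.-integrable setT (EFin \o v) ->
  (forall c d : R, (\int[m]_(t in val @^-1` `]c, d[) (v t)%:E = 0)%E) ->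
  {ae m, forall t, v t = 0}.
Proof.
move=> iv v0.
have iE (E : set Omega) : measurable E -> m.-integrable E (EFin \o v).
  by move=> mE; exact: (integrableS measurableT mE (@subsetT _ E) iv).
have borel (B : set R) : measurable B ->
    (\int[m]_(t in val @^-1` B) (v t)%:E = 0)%E.
  rewrite [X in X B -> _](RGenOpens.measurableE R) => mB.
  pose P := [set B : set (measurableTypeR R) |
    (\int[m]_(t in val @^-1` B) (v t)%:E = 0)%E].
  have ab := interval_lt x0ab.
  have PT : (\int[m]_t (v t)%:E = 0)%E.
    rewrite -[RHS](v0 a b); congr (integral m _ _).
    by apply/seteqP; split => // t _ /=; rewrite in_itv/=; exact: interval_val_itv.
  have mval (A : set (measurableTypeR R)) : measurable A -> measurable (val @^-1` A).
    exact: measurable_val_preimage.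
  apply: (@dynkin_induction _ (measurableTypeR R) _ P (RGenOpens.measurableE R) _ _ _ _ _ _ mB).
  - move=> _ _ [x [y ->]] [z [w ->]]; exists (Num.max x z), (Num.min y w).
    apply/seteqP; split => t /=; rewrite !in_itv/= gt_max lt_min.
      by move=> [/andP[-> ->] /andP[-> ->]].
    by move=> /andP[/andP[-> ->] /andP[-> ->]].
  - by rewrite /P/= preimage_setT.
  - by move=> _ [x [y ->]]; exact: v0.
  - move=> S mS PS; rewrite /P/= preimage_setC.
    have := PT; rewrite -(setvU (val @^-1` S)) integral_setU_EFin//.
    + by rewrite [X in (_ + X)%E]PS adde0.
    + by apply: measurableC; exact: (mval _ mS).
    + exact: (mval _ mS).
    + by rewrite setvU; case/integrableP: iv => /measurable_EFinP.
    + by rewrite disj_set2E setICl.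
  - move=> F mF tF PF; rewrite /P/= preimage_bigcup integral_bigcup//.
    + by apply: eseries0 => i _ _; exact: PF.
    + apply/trivIsetP => i j _ _ ij; rewrite -preimage_setI.
      by move/trivIsetP : tF => ->//; rewrite preimage_set0.
    + by move=> i; exact: (mval _ (mF i)).
    + by apply: iE; apply: bigcupT_measurable => i; exact: (mval _ (mF i)).
suff : ae_eq m setT (EFin \o v) (cst 0%E).
  by apply: filterS => t /(_ Logic.I) /= [].
apply: integral_ae_eq => // E _ mE.
rewrite [RHS]integral0.
have [B [M [mB mM M0 EM]]] := interval_measurable_borel E mE.
rewrite (negligible_integral _ mE _ M0)//.
- by rewrite EM; apply: borel; exact: measurableD.
- exact: measurable_val_preimage.
- exact: iE.
Qed.

(** By dominated convergence along [smooth_bump], [v] has zero integral over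
    every open interval, so that [ae_eq0_of_itv] applies. *)
Lemma fundamental_lemma (v : Omega -> R) : m.-integrable setT (EFin \o v) ->
  (forall phi, test_function a b phi -> \int[m]_t (v t * phi (val t)) = 0) ->
  {ae m, forall t, v t = 0}.
Proof.
move=> iv v0; apply: ae_eq0_of_itv => // c d.
(* Test functions must be supported in the open interval from a to b. *)
pose c' := Num.max a c; pose d' := Num.min b d.
have -> : val @^-1` `]c, d[ = val @^-1` `]c', d'[.
  apply/seteqP; split => t /=; rewrite !in_itv/= gt_max lt_min; have /andP[-> ->]/= := interval_val_itv x0ab t.
    by [].
  by [].
have mv : measurable_fun setT v by case/integrableP : iv => /measurable_EFinP.
have tb n : test_function a b (smooth_bump c' d' n).
  by apply: test_function_bump; rewrite ?le_max ?ge_min lexx.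
have ib n : m.-integrable setT (EFin \o (fun t => v t * smooth_bump c' d' n (val t))).
  apply: (le_integrable measurableT _ _ iv).
    apply/measurable_EFinP.
    exact: (measurable_funM mv (measurable_derive1n 0 (tb n))).
  move=> t _; rewrite /= lee_fin normrM ler_piMr//.
  by have /andP[? ?] := bump_itv c' d' n (val t); rewrite ger0_norm.
have mI : measurable (val @^-1` `]c', d'[).
  by apply: measurable_val_preimage; exact: measurable_itv.
have cv := @dominated_cvg _ _ _ m setT measurableT
  (fun n t => (v t * smooth_bump c' d' n (val t))%:E)
  (fun t => (v t * \1_(val @^-1` `]c', d'[) t)%:E) (abse \o (EFin \o v))
  (fun n => measurable_int _ (ib n)).
rewrite integral_mkcond.
transitivity (\int[m]_t (v t * \1_(val @^-1` `]c', d'[) t)%:E)%E.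
  apply: eq_integral => t _; rewrite patchE indicE.
  by case: ifPn => _; rewrite ?mulr1 ?mulr0.
have int0 n : (\int[m]_t (v t * smooth_bump c' d' n (val t))%:E = 0)%E.
  rewrite -[LHS]fineK ?integrable_fin_num//; last exact: ib.
  by have := v0 _ (tb n); rewrite /Rintegral => ->.
set I := (X in X = _).
have -> : I = limn (fun n => \int[m]_t (v t * smooth_bump c' d' n (val t))%:E)%E.
  apply/esym/cvg_lim => //; apply: cv => //.
  - move=> t _; apply: cvg_EFin; first exact: nearW.
    by apply: cvgM; [exact: cvg_cst|exact: cvg_bump].
  - exact: integrable_abse.
  - move=> n t _; rewrite /= lee_fin normrM ler_piMr//.
    by have /andP[? ?] := bump_itv c' d' n (val t); rewrite ger0_norm.
by under eq_fun do rewrite int0; exact: lim_cst.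
Qed.

End fundamental_lemma.

(** * Primitives of integrable functions *)

Lemma integrable_mulr_bounded d (T : measurableType d) (R : realType)
    (mu : {measure set T -> \bar R}) (v h : T -> R) (M : R) :
  mu.-integrable setT (EFin \o v) -> measurable_fun setT h ->
  (forall t, `|h t| <= M) -> mu.-integrable setT (EFin \o (fun t => v t * h t)).
Proof.
move=> iv mh hM.
have mv : measurable_fun setT v by case/integrableP : iv => /measurable_EFinP.
have iMv : mu.-integrable setT (fun t => M%:E * (v t)%:E)%E.
  exact: integrableZl.
apply: (le_integrable measurableT _ _ iMv).
  by apply/measurable_EFinP; exact: measurable_funM.
move=> t _; rewrite /= lee_fin !normrM mulrC ler_wpM2r//.
by rewrite (le_trans (hM t))// ler_norm.
Qed.

Lemma integrable_mulr d (T : measurableType d) (R : realType)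
    (mu : {measure set T -> \bar R}) (r : R) (f : T -> R) :
  mu.-integrable setT (EFin \o f) ->
  mu.-integrable setT (EFin \o (fun t => r * f t)).
Proof.
move=> fi; rewrite (_ : _ \o _ = (fun t => r%:E * (f t)%:E)%E)//.
exact: integrableZl.
Qed.

Section primitive.
Context {R : realType} {a b x0 : R} (x0ab : x0 \in `]a, b[).
Local Notation Omega := (interval_space x0ab).
Local Notation m := (interval_measure x0ab).
Local Notation val := (@interval_val R a b x0 x0ab).

(** The kernel [1_(t < x) - 1_(t < x0)], whose integral against [v] is the
    oriented integral of [v] from [x0] to [x]. *)
Definition anchor_kernel (x t : Omega) : R :=
  (val t < val x)%R%:R - (val t < x0)%R%:R.

(** The primitive of [v] vanishing at the base point. *)
Definition primitive (v : Omega -> R) (x : Omega) : R :=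
  \int[m]_t (v t * anchor_kernel x t).

Lemma anchor_kernel_le1 x t : `|anchor_kernel x t| <= 1.
Proof.
by rewrite /anchor_kernel; do 2 case: (_ < _);
  rewrite ?subrr ?subr0 ?sub0r ?normrN ?normr0 ?normr1.
Qed.

Lemma measurable_natb d (T : measurableType d) (f : T -> bool) :
  measurable_fun setT f -> measurable_fun setT (fun t => (f t)%:R : R).
Proof.
by move=> mf; apply: (measurableT_comp (f := fun b : bool => b%:R : R)).
Qed.

Lemma measurable_anchor_kernel :
  measurable_fun setT (fun z : Omega * Omega => anchor_kernel z.1 z.2).
Proof.
have m1 : measurable_fun setT (fun z : Omega * Omega => val z.1).
  exact: (measurableT_comp (measurable_val x0ab) measurable_fst).
have m2 : measurable_fun setT (fun z : Omega * Omega => val z.2).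
  exact: (measurableT_comp (measurable_val x0ab) measurable_snd).
apply: measurable_funB; apply: measurable_natb; apply: measurable_fun_ltr => //.
Qed.

Lemma measurable_anchor_kernel2 x : measurable_fun setT (anchor_kernel x).
Proof.
exact: (measurableT_comp measurable_anchor_kernel (measurable_pair1 x)).
Qed.

Lemma integrable_anchor_kernel v x : m.-integrable setT (EFin \o v) ->
  m.-integrable setT (EFin \o (fun t => v t * anchor_kernel x t)).
Proof.
move=> iv; apply: (integrable_mulr_bounded _ _ _ _ _ _ 1 iv).
  exact: measurable_anchor_kernel2.
exact: anchor_kernel_le1.
Qed.

Lemma integrable_test (v : Omega -> R) phi n : m.-integrable setT (EFin \o v) ->
  test_function a b phi ->
  m.-integrable setT (EFin \o (fun t => v t * derive1n n phi (val t))).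
Proof.
move=> iv tphi; have [M HM] := test_function_bounded x0ab n tphi.
exact: (integrable_mulr_bounded _ _ _ _ _ _ M iv (measurable_derive1n n tphi) HM).
Qed.

Lemma integrable_bounded (h : Omega -> R) (M : R) : measurable_fun setT h ->
  (forall t, `|h t| <= M) -> m.-integrable setT (EFin \o h).
Proof.
move=> mh hM; apply: measurable_bounded_integrable => //.
  exact: interval_measure_fin.
exists M; split; first exact: num_real.
by move=> y My t _ /=; rewrite (le_trans (hM t))// ltW.
Qed.

Lemma integrable_cst1 (r : R) : m.-integrable setT (EFin \o (fun=> r)).
Proof. exact: (integrable_bounded _ `|r| (measurable_cst r)). Qed.

Lemma integrable_test1 phi n : test_function a b phi ->
  m.-integrable setT (EFin \o (fun t => derive1n n phi (val t))).
Proof.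
move=> tphi; have [M HM] := test_function_bounded x0ab n tphi.
exact: (integrable_bounded _ M (measurable_derive1n n tphi)).
Qed.

(** The fundamental theorem of calculus on [`]a, x[], the test function
    vanishing at [a]. *)
Lemma integral_derive_test phi (x : R) : test_function a b phi -> a < x <= b ->
  \int[m]_t (derive1n 1 phi (val t) * (val t < x)%R%:R) = phi x.
Proof.
move=> tphi /andP[ax xb]; have ab := interval_lt x0ab.
have d1 y : derivable phi y 1 by case: tphi => /(_ 0%N y).
have cphi : continuous phi.
  by move=> y; exact/differentiable_continuous/derivable1_diffP/d1.
have cphi' : continuous (derive1n 1 phi).
  move=> y; apply/differentiable_continuous/derivable1_diffP.
  by case: tphi => /(_ 1%N y).
have mphi' : measurable_fun setT (derive1n 1 phi) by exact: continuous_measurable_fun.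
have i1 := integrable_test1 phi 1 tphi.
have D : `]a, x[%classic `<=` [set` `]a, b[].
  by move=> y /=; rewrite !in_itv/= => /andP[-> yx]; exact: lt_le_trans xb.
have mD : measurable (`]a, x[%classic : set R) by exact: measurable_itv.
transitivity (fine (\int[m]_(t in val @^-1` `]a, x[) (derive1n 1 phi (val t))%:E)%E).
  congr fine; rewrite [RHS]integral_mkcond; apply: eq_integral => t _.
  rewrite patchE (_ : (t \in _) = (val t < x)).
    by case: (_ < _); rewrite ?mulr1 ?mulr0.
  have /andP[at_ _] := interval_val_itv x0ab t.
  by apply/idP/idP; rewrite inE/= in_itv/= at_.
rewrite interval_integral_preimage//; last first.
  apply: (integrableS measurableT _ _ i1) => //.
  exact: measurable_val_preimage.
rewrite -(integral_itv_bndoo true false); last first.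
  by apply/measurable_EFinP; exact: measurable_funTS.
have dphi : derivable_oo_LRcontinuous phi a x.
  split; first by move=> y _; exact: d1.
  - by apply: cvg_at_right_filter; exact: cphi.
  - by apply: cvg_at_left_filter; exact: cphi.
have wphi' : {within `[a, x], continuous (derive1n 1 phi)}.
  exact: continuous_subspaceT.
rewrite (continuous_FTC2 ax wphi' dphi (fun _ _ => erefl)).
by rewrite -EFinB/= [X in _ - X](test_function_out a b) ?subr0 ?lexx.
Qed.
End primitive.

Section integration_by_parts.
Context {R : realType} {a b x0 : R} (x0ab : x0 \in `]a, b[).
Local Notation Omega := (interval_space x0ab).
Local Notation m := (interval_measure x0ab).
Local Notation val := (@interval_val R a b x0 x0ab).

Lemma integral_derive_test0 phi : test_function a b phi ->
  \int[m]_t derive1n 1 phi (val t) = 0.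
Proof.
move=> tphi; have ab := interval_lt x0ab.
rewrite -(test_function_out a b b phi) ?lexx ?orbT//.
rewrite -(integral_derive_test x0ab phi b tphi) ?ab ?lexx//.
apply: eq_Rintegral => t _.
by have /andP[_ ->] := interval_val_itv x0ab t; rewrite mulr1.
Qed.

(** Integrating [phi'] over [x > t] gives [phi b - phi t = - phi t]; the term
    [1_(t < x0)] of the kernel contributes nothing, [phi'] having mean zero. *)
Lemma integral_kernel_derive_test phi t : test_function a b phi ->
  \int[m]_x (anchor_kernel x0ab x t * derive1n 1 phi (val x)) = - phi (val t).
Proof.
move=> tphi; have /andP[at_ tb] := interval_val_itv x0ab t.
have i1 := integrable_test1 x0ab phi 1 tphi.
have ile : m.-integrable setT
    (EFin \o (fun x => derive1n 1 phi (val x) * (val x <= val t)%R%:R)).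
  apply: (integrable_mulr_bounded _ _ _ _ _ _ 1 i1).
    apply: measurable_natb.
    exact: (measurable_fun_ler (measurable_val x0ab) (measurable_cst _)).
  by move=> x; rewrite normr_nat lern1 leq_b1.
have le_lt : \int[m]_x (derive1n 1 phi (val x) * (val x <= val t)%R%:R) =
    phi (val t).
  rewrite -(integral_derive_test x0ab phi (val t) tphi) ?at_ ?ltW//.
  congr fine; apply: ae_eq_integral.
  - exact: measurableT.
  - by case/integrableP: ile.
  - apply/measurable_EFinP; apply: measurable_funM.
      exact: (measurable_derive1n 1 tphi).
    apply: measurable_natb.
    exact: (measurable_fun_ltr (measurable_val x0ab) (measurable_cst _)).
  - exists (val @^-1` [set val t]); split.
    + exact: measurable_val_preimage.
    + apply/eqP; rewrite eq_le measure_ge0 andbT.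
      rewrite [leLHS](interval_measure_preimage x0ab [set val t]).
      rewrite -(lebesgue_measure_set1 (val t)).
      by rewrite le_measure// ?inE//; exact: measurableI.
    + move=> x /= /not_implyP[_ Hx]; apply: contrapT => xt; apply: Hx.
      by rewrite le_eqVlt; case: eqP.
(* The kernel is 1 - 1_(t < x0) minus the indicator of x <= t. *)
transitivity (\int[m]_x ((1 - (val t < x0)%R%:R) * derive1n 1 phi (val x) -
    derive1n 1 phi (val x) * (val x <= val t)%R%:R)).
  apply: eq_Rintegral => x _; rewrite /anchor_kernel ltNge.
  by case: (_ <= _); case: (_ < _) => /=; ring.
rewrite (RintegralB measurableT (integrable_mulr _ _ _ m _ _ i1) ile).
by rewrite (RintegralZl _ measurableT i1) integral_derive_test0// mulr0 sub0r le_lt.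
Qed.

Lemma integrable_prod_snd v : m.-integrable setT (EFin \o v) ->
  (m \x m)%E.-integrable setT (EFin \o (fun z : Omega * Omega => v z.2)).
Proof.
move=> iv; have /integrableP[/measurable_EFinP mv vlt] := iv.
apply/integrable12ltyP.
  by apply/measurable_EFinP; exact: (measurableT_comp mv measurable_snd).
rewrite /= integral_cst//= lte_mul_pinfty ?integral_ge0//.
  by rewrite ge0_fin_numE ?integral_ge0.
exact: interval_measure_fin.
Qed.

Lemma integrable_prod_kernel v : m.-integrable setT (EFin \o v) ->
  (m \x m)%E.-integrable setT
    (EFin \o (fun z : Omega * Omega => v z.2 * anchor_kernel x0ab z.1 z.2)).
Proof.
move=> iv; apply: (integrable_mulr_bounded _ _ _ _ _ _ 1 (integrable_prod_snd v iv)).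
  exact: measurable_anchor_kernel.
by move=> z; exact: anchor_kernel_le1.
Qed.

Lemma measurable_primitive v : m.-integrable setT (EFin \o v) ->
  measurable_fun setT (primitive x0ab v).
Proof.
move=> iv; apply/measurable_EFinP.
apply: eq_measurable_fun (measurable_fubini_F (integrable_prod_kernel v iv)).
move=> x _; rewrite /= /primitive /Rintegral fineK//.
exact: (integrable_fin_num measurableT (integrable_anchor_kernel x0ab v x iv)).
Qed.

Lemma primitive_bounded v x : m.-integrable setT (EFin \o v) ->
  `|primitive x0ab v x| <= \int[m]_t `|v t|.
Proof.
move=> iv; have ik := integrable_anchor_kernel x0ab v x iv.
apply: (le_trans (le_normr_Rintegral measurableT ik)).
apply: (le_Rintegral measurableT (integrable_norm ik) (integrable_norm iv)).
by move=> t _; rewrite /= normrM ler_piMr// anchor_kernel_le1.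
Qed.

Lemma integrable_primitive v : m.-integrable setT (EFin \o v) ->
  m.-integrable setT (EFin \o primitive x0ab v).
Proof.
move=> iv; apply: (integrable_bounded _ _ (\int[m]_t `|v t|)).
  exact: measurable_primitive.
by move=> x; exact: primitive_bounded.
Qed.

(** The primitive of [v] has weak derivative [v]: exchange the two integrals
    and apply [integral_kernel_derive_test]. *)
Lemma primitive_by_parts v phi : m.-integrable setT (EFin \o v) ->
  test_function a b phi ->
  \int[m]_x (primitive x0ab v x * derive1n 1 phi (val x)) =
  - \int[m]_t (v t * phi (val t)).
Proof.
move=> iv tphi; have [M HM] := test_function_bounded x0ab 1 tphi.
have mphi := measurable_derive1n (x0ab := x0ab) 1 tphi.
pose f (z : Omega * Omega) : R :=
  v z.2 * anchor_kernel x0ab z.1 z.2 * derive1n 1 phi (val z.1).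
have intf : (m \x m)%E.-integrable setT (EFin \o f).
  apply: (integrable_mulr_bounded _ _ _ _ _ _ M (integrable_prod_kernel v iv)).
    exact: (measurableT_comp mphi measurable_fst).
  by move=> z; exact: HM.
have := Fubini intf.
rewrite /f/= => F.
have ik x := integrable_anchor_kernel x0ab v x iv.
have ikphi t : m.-integrable setT
    (EFin \o (fun x => anchor_kernel x0ab x t * derive1n 1 phi (val x))).
  under eq_fun do rewrite mulrC.
  apply: (integrable_mulr_bounded _ _ _ _ _ _ 1 (integrable_test1 x0ab phi 1 tphi)).
    exact: (measurableT_comp (measurable_anchor_kernel x0ab) (measurable_pair2 t)).
  by move=> x; exact: anchor_kernel_le1.
have iphi := integrable_test x0ab v phi 0 iv tphi.
transitivity (\int[m]_t (-1 * (v t * phi (val t)))); last first.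
  by rewrite (RintegralZl (-1) measurableT iphi) mulN1r.
congr fine; transitivity (\int[m]_x \int[m]_y
    (v y * anchor_kernel x0ab x y * derive1n 1 phi (val x))%:E)%E.
  apply: eq_integral => x _; rewrite EFinM /primitive /Rintegral.
  rewrite (fineK (integrable_fin_num measurableT (ik x))).
  exact/esym/(integralZr measurableT (ik x)).
rewrite F; apply: eq_integral => t _.
have -> : -1 * (v t * phi (val t)) =
    v t * \int[m]_x (anchor_kernel x0ab x t * derive1n 1 phi (val x)).
  by rewrite (integral_kernel_derive_test phi t tphi) mulN1r mulrN.
rewrite EFinM /Rintegral.
rewrite (fineK (integrable_fin_num measurableT (ikphi t))).
rewrite -(integralZl measurableT (ikphi t)).
by apply: eq_integral => x _; rewrite /= -EFinM mulrA.
Qed.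
End integration_by_parts.

(** * The du Bois-Reymond lemma *)

(** A test function of mean zero is the derivative of a test function. *)
Lemma test_function_primitive {R : realType} (a b : R) (theta : R -> R) : a < b ->
  test_function a b theta ->
  \int[lebesgue_measure]_(x in `]a, b[) theta x = 0 ->
  exists2 phi, test_function a b phi & derive1n 1 phi = theta.
Proof.
move=> ab ttheta theta0.
have [c [d [ac cd db H]]] := test_function_support _ _ _ ab ttheta.
have stheta : smooth theta by case: ttheta.
have ctheta : continuous theta := smooth_continuous _ 0 stheta.
have Z x : (x < c) || (d < x) -> theta x = 0.
  move=> xcd; apply/eqP; apply: contraLR xcd => /H/andP[cx xd].
  by rewrite negb_or -!leNgt cx.
have iT : lebesgue_measure.-integrable setT (EFin \o theta).
  have icd : lebesgue_measure.-integrable `[c, d] (EFin \o theta).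
    apply: continuous_compact_integrable; first exact: segment_compact.
    exact: continuous_subspaceT.
  move/integrable_mkcond : icd => /(_ (measurable_itv _)).
  congr (integrable _ _ _); apply/funext => x.
  rewrite patchE; case: ifPn => //; rewrite notin_setE/= in_itv/= => /negP.
  by rewrite negb_and -!ltNge => /Z ->.
pose phi (x : R) : R := \int[lebesgue_measure]_(t in `]-oo, x]) theta t.
have dphi x : derivable phi x 1 /\ derive1 phi x = theta x.
  apply: (@continuous_FTC1 R theta -oo%O x (x + 1)) => //; last exact: ctheta.
    by rewrite ltrDl.
  by apply: (integrableS measurableT _ _ iT).
  by rewrite ltNyr.
have phi' : derive1 phi = theta by apply/funext => y; case: (dphi y).
exists phi; last exact: phi'.
apply: (smooth_test_function a b c d phi ac db).
  by apply: (smooth_primitive phi (fun x => proj1 (dphi x))); rewrite phi'.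
move=> x; apply: contraNT; rewrite negb_and -!ltNge => /orP[xc|dx]; apply/eqP.
  rewrite /phi /Rintegral integral_mkcond (_ : _ \_ _ = cst 0%E).
    by rewrite integral0.
  apply/funext => t; rewrite patchE; case: ifPn => //.
  rewrite inE/= in_itv/= => tx; rewrite Z//.
  by rewrite (le_lt_trans tx xc).
rewrite -theta0 /phi /Rintegral integral_mkcond [in RHS]integral_mkcond.
congr fine; apply: eq_integral => t _; rewrite !patchE.
have [tcd|] := boolP ((t < c) || (d < t)).
  by rewrite Z//; do 2 case: ifP.
rewrite negb_or -!leNgt => /andP[ct td].
rewrite !mem_set//= in_itv/=; last by apply: le_trans td _; exact: ltW.
by rewrite (lt_le_trans ac ct) (le_lt_trans td db).
Qed.

Section du_bois_reymond.
Context {R : realType} {a b x0 : R} (x0ab : x0 \in `]a, b[).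
Local Notation Omega := (interval_space x0ab).
Local Notation m := (interval_measure x0ab).
Local Notation val := (@interval_val R a b x0 x0ab).

Lemma interval_measure_gt0 : (0 < m setT)%E.
Proof.
have ab := interval_lt x0ab.
rewrite -(preimage_setT val) (interval_measure_preimage x0ab) setTI.
by rewrite lebesgue_measure_itv/= lte_fin ab -EFinB lte_fin subr_gt0.
Qed.

(** Fix a test function [eta] with nonzero integral.  Any test function
    [psi] is a multiple of [eta] plus a function of mean zero, which is the
    derivative of a test function; hence [w] minus a suitable constant is
    orthogonal to [psi]. *)
Lemma du_bois_reymond (w : Omega -> R) : m.-integrable setT (EFin \o w) ->
  (forall phi, test_function a b phi ->
     \int[m]_t (w t * derive1n 1 phi (val t)) = 0) ->
  exists c, {ae m, forall t, w t = c}.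
Proof.
move=> iw H; have ab := interval_lt x0ab.
pose I phi := \int[m]_t phi (val t).
have itest phi (tphi : test_function a b phi) := integrable_test1 x0ab phi 0 tphi.
(* Otherwise the constant function 1 would vanish almost everywhere. *)
have [eta teta I0] : exists2 eta, test_function a b eta & I eta != 0.
  apply: contrapT => /forall2NP N.
  have : {ae m, forall t : Omega, (1 : R) = 0}.
    apply: (fundamental_lemma x0ab (fun=> 1)); first exact: integrable_cst1.
    move=> phi tphi; have [//|/negP/negPn/eqP <-] := N phi.
    by apply: eq_Rintegral => t _; rewrite mul1r.
  move=> [S [mS S0 NS]].
  have := interval_measure_gt0; rewrite (_ : setT = S) ?S0 ?ltxx//.
  by apply/esym/seteqP; split => // t _; apply: NS => /eqP; rewrite oner_eq0.
pose c := \int[m]_t (w t * eta (val t)) / I eta.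
exists c.
have iwc : m.-integrable setT (EFin \o (fun t => w t - c)).
  exact: (integrableB measurableT iw (integrable_cst1 x0ab c)).
suff : {ae m, forall t, w t - c = 0}.
  by apply: filterS => t /eqP; rewrite subr_eq0 => /eqP.
apply: (fundamental_lemma _ _ iwc) => psi tpsi.
pose s := I psi / I eta.
pose theta x := 1 * psi x + (- s) * eta x.
have ttheta : test_function a b theta by exact: test_function_linear.
have iwt phi (tphi : test_function a b phi) := integrable_test x0ab _ _ 0 iw tphi.
have [|phi tphi phi'] := test_function_primitive a b theta ab ttheta.
  transitivity (I theta).
    rewrite /I /Rintegral; congr fine.
    rewrite -(interval_integral_preimage x0ab theta `]a, b[%classic).
    - congr (integral m _ _); apply/seteqP; split => // t _ /=.
      by rewrite in_itv/=; exact: interval_val_itv.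
    - exact: measurable_itv.
    - by [].
    - apply: continuous_measurable_fun; apply: (smooth_continuous _ 0).
      by case: ttheta.
    - apply: (integrableS measurableT _ _ (itest _ ttheta)) => //.
      by apply: measurable_val_preimage; exact: measurable_itv.
  transitivity (I psi - s * I eta).
    rewrite /I -RintegralZl ?itest// -RintegralB ?itest//.
      by apply: eq_Rintegral => t _; rewrite /theta mul1r mulNr.
    exact: integrable_mulr (itest _ teta).
  by rewrite /s divfK// subrr.
have := H _ tphi; rewrite phi' => Hw.
transitivity (\int[m]_t (w t * theta (val t)) + (s * \int[m]_t (w t * eta (val t)) - c * I psi)).
  rewrite /I -!RintegralZl ?itest ?iwt//.
  have iw1 : m.-integrable setT (EFin \o (fun t => s * (w t * eta (val t)))).
    exact: integrable_mulr (iwt _ teta).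
  have iw2 : m.-integrable setT (EFin \o (fun t => c * psi (val t))).
    exact: integrable_mulr (itest _ tpsi).
  have iw3 : m.-integrable setT (EFin \o (fun t => w t * theta (val t))).
    exact: (iwt _ ttheta).
  rewrite -(RintegralB measurableT iw1 iw2).
  rewrite -(RintegralD measurableT iw3 (integrableB measurableT iw1 iw2)).
  by apply: eq_Rintegral => t _; rewrite /theta; ring.
by rewrite Hw add0r /c /s; ring.
Qed.
End du_bois_reymond.

(** * Absolute continuity of the integral *)

Lemma sum_natb_le1 {R : realType} n (P : 'I_n -> bool) :
  (forall i j, P i -> P j -> i = j) -> \sum_i (P i)%:R <= 1 :> R.
Proof.
move=> H; have [i Pi|P0] := pickP P.
  rewrite (bigD1 i)//= Pi big1 ?addr0// => j ji.
  by apply/eqP; rewrite pnatr_eq0 eqb0; apply: contra ji => Pj; rewrite (H j i).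
by rewrite big1// => i _; rewrite P0.
Qed.

Lemma Rintegral_sum d (T : measurableType d) (R : realType)
    (mu : {measure set T -> \bar R}) n (f : 'I_n -> T -> R) :
  (forall i, mu.-integrable setT (EFin \o f i)) ->
  mu.-integrable setT (EFin \o (fun t => \sum_i f i t)) /\
  \int[mu]_t (\sum_i f i t) = \sum_i \int[mu]_t f i t.
Proof.
elim: n f => [|n IH] f fi.
  have -> : (fun t => \sum_i f i t) = cst 0 by apply/funext => t; rewrite big_ord0.
  by split; [exact: integrable0|rewrite big_ord0 Rintegral_cst// mul0r].
have [is' Es] := IH (fun i => f (lift ord0 i)) (fun i => fi _).
have E : (fun t => \sum_i f i t) =
    (fun t => f ord0 t + \sum_i f (lift ord0 i) t).
  by apply/funext => t; rewrite big_ord_recl.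
rewrite E big_ord_recl -Es; split.
  exact: (integrableD measurableT (fi ord0) is').
by rewrite RintegralD.
Qed.

(** Truncating a nonnegative integrable function at a high enough level
    changes its integral by less than [e]. *)
Lemma integrable_truncation d (T : measurableType d) (R : realType)
    (mu : {measure set T -> \bar R}) (g : T -> R) :
  mu.-integrable setT (EFin \o g) -> (forall t, 0 <= g t) ->
  forall e : R, 0 < e -> exists n : nat,
    mu.-integrable setT (EFin \o (fun t => g t - Num.min (g t) n%:R)) /\
    \int[mu]_t (g t - Num.min (g t) n%:R) < e.
Proof.
move=> ig g0 e e0.
have mg : measurable_fun setT g by case/integrableP : ig => /measurable_EFinP.
have bd n t : 0 <= g t - Num.min (g t) n%:R <= g t.
  by rewrite subr_ge0 ge_min lexx/= lerBlDr lerDl le_min g0 ler0n.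
have iu n : mu.-integrable setT (EFin \o (fun t => g t - Num.min (g t) n%:R)).
  apply: (le_integrable measurableT _ _ ig).
    apply/measurable_EFinP; apply: measurable_funB => //.
    by apply: measurable_minr.
  move=> t _; rewrite /= lee_fin; have /andP[h1 h2] := bd n t.
  by rewrite !ger0_norm.
have cv := @dominated_cvg _ _ _ mu setT measurableT
  (fun n t => (g t - Num.min (g t) n%:R)%:E) (cst 0%E) (EFin \o g)
  (fun n => measurable_int _ (iu n)).
have {}cv : (\int[mu]_t (g t - Num.min (g t) n%:R)%:E @[n --> \oo] --> 0)%E.
  rewrite -[X in _ --> X](integral0 mu setT); apply: cv => //.
    move=> t _; apply: cvg_near_cst; near=> n.
    have tn : g t <= n%:R by near: n; exact: nbhs_infty_ger.
    by rewrite min_l// subrr.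
  by move=> n t _; rewrite /= lee_fin; have /andP[h1 h2] := bd n t; rewrite ger0_norm.
have /fine_cvgP[_ /cvgr0_norm_lt/(_ e e0)] := cv.
move=> [N _ /(_ N (leqnn N)) HN]; exists N; split => //.
exact: le_lt_trans (ler_norm _) HN.
Unshelve. all: by end_near. Qed.

Section interval_ac.
Context {R : realType} {a b x0 : R} (x0ab : x0 \in `]a, b[).
Local Notation Omega := (interval_space x0ab).
Local Notation m := (interval_measure x0ab).
Local Notation val := (@interval_val R a b x0 x0ab).

(** The indicator function of [`[s, t[]. *)
Definition itv_indicator (s t r : Omega) : R := (val s <= val r < val t)%R%:R.

Lemma itv_indicator_le1 s t r : `|itv_indicator s t r| <= 1.
Proof. by rewrite normr_nat lern1 leq_b1. Qed.

Lemma measurable_itv_indicator s t : measurable_fun setT (itv_indicator s t).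
Proof.
have mv := measurable_val x0ab.
apply: measurable_natb; apply: measurable_and.
  by apply: measurable_fun_ler => //; exact: measurable_cst.
by apply: measurable_fun_ltr => //; exact: measurable_cst.
Qed.

Lemma integral_itv_indicator s t : val s <= val t ->
  \int[m]_r itv_indicator s t r = val t - val s.
Proof.
move=> st.
have /andP[as_ _] := interval_val_itv x0ab s.
have /andP[_ tb] := interval_val_itv x0ab t.
transitivity (fine (m (val @^-1` `[val s, val t[))).
  rewrite /Rintegral -[X in m X]setIT -integral_indic//; last first.
    by apply: measurable_val_preimage; exact: measurable_itv.
  congr fine; apply: eq_integral => r _; rewrite /itv_indicator indicE.
  congr (_%:R%:E); congr nat_of_bool.
  by apply/idP/idP; rewrite inE/= in_itv.
rewrite (interval_measure_preimage x0ab `[val s, val t[%classic) setIidl.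
  by rewrite lebesgue_measure_itv/= lte_fin; case: ltgtP st => // -> _; rewrite subrr.
move=> r /=; rewrite !in_itv/= => /andP[sr rt].
by rewrite (lt_le_trans as_ sr) (lt_trans rt tb).
Qed.

(** Split [g] into a bounded part and a part of small integral; the bounded
    part contributes at most the bound times the total length.  Disjointness is
    used in the form that the indicators of the intervals add up to at most
    [1]. *)
Lemma integral_absolutely_continuous (g : Omega -> R) :
  m.-integrable setT (EFin \o g) -> (forall t, 0 <= g t) ->
  forall e : R, 0 < e -> exists2 d : R, 0 < d &
    forall n (s t : 'I_n -> Omega),
      (forall i, val (s i) <= val (t i)) ->
      (forall i j, i != j -> val (t i) <= val (s j) \/ val (t j) <= val (s i)) ->
      \sum_i (val (t i) - val (s i)) < d ->
      \sum_i \int[m]_r (g r * itv_indicator (s i) (t i) r) < e.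
Proof.
move=> ig g0 e e0.
have e2 : 0 < e / 2 by rewrite divr_gt0.
have [N [ih hN]] := integrable_truncation _ _ _ _ _ ig g0 _ e2.
set h := (fun t => _) in ih hN.
have h0 t : 0 <= h t by rewrite /h subr_ge0 ge_min lexx.
(* N may be zero, hence the successor. *)
exists (e / 2 / N.+1%:R); first by rewrite divr_gt0.
move=> n s t st dis sumd.
pose J i := itv_indicator (s i) (t i).
have iJ i : m.-integrable setT (EFin \o J i).
  apply: (integrable_bounded _ _ 1); first exact: measurable_itv_indicator.
  exact: itv_indicator_le1.
have iNJ i : m.-integrable setT (EFin \o (fun r => N%:R * J i r)).
  exact: integrable_mulr.
have ihJ i : m.-integrable setT (EFin \o (fun r => h r * J i r)).
  apply: (integrable_mulr_bounded _ _ _ _ _ _ 1 ih).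
    exact: measurable_itv_indicator.
  exact: itv_indicator_le1.
have igJ i : m.-integrable setT (EFin \o (fun r => g r * J i r)).
  apply: (integrable_mulr_bounded _ _ _ _ _ _ 1 ig).
    exact: measurable_itv_indicator.
  exact: itv_indicator_le1.
have step i : \int[m]_r (g r * J i r) <=
    \int[m]_r (h r * J i r) + N%:R * (val (t i) - val (s i)).
  rewrite -(integral_itv_indicator (s i) (t i) (st i)).
  rewrite -(RintegralZl N%:R measurableT (iJ i)).
  rewrite -(RintegralD measurableT (ihJ i) (iNJ i)).
  apply: (le_Rintegral measurableT (igJ i)).
    exact: (integrableD measurableT (ihJ i) (iNJ i)).
  move=> r _; rewrite -mulrDl ler_wpM2r//.
  by rewrite /h -addrA lerDl addrC subr_ge0 ge_min lexx orbT.
apply: (@le_lt_trans _ _ (\sum_i (\int[m]_r (h r * J i r) +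
    N%:R * (val (t i) - val (s i))))).
  by apply: ler_sum => i _; exact: step.
rewrite big_split/= -mulr_sumr [ltRHS](splitr e).
have [ihs <-] := Rintegral_sum _ _ _ m _ _ ihJ.
apply: ler_ltD.
  apply: (le_trans _ (ltW hN)); apply: (le_Rintegral measurableT ihs ih) => r _.
  rewrite -mulr_sumr ler_piMr//; apply: sum_natb_le1 => i j.
  move=> /andP[si ti] /andP[sj tj]; apply/eqP; apply: contraT => ij.
  by case: (dis i j ij) => ?; lra.
apply: (@le_lt_trans _ _ (N.+1%:R * \sum_i (val (t i) - val (s i)))).
  rewrite ler_wpM2r ?ler_nat// sumr_ge0// => i _.
  by rewrite subr_ge0.
by rewrite mulrC -ltr_pdivlMr.
Qed.
End interval_ac.

(** * Weak derivatives of complex functions *)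

Local Open Scope complex_scope.
Import Normc.

Lemma normc_bounds {R : realType} (z : R[i]) :
  [/\ `|complex.Re z| <= Normc.normc z, `|complex.Im z| <= Normc.normc z &
   Normc.normc z <= `|complex.Re z| + `|complex.Im z|].
Proof.
case: z => x y /=; split.
- by rewrite -sqrtr_sqr ler_sqrt ?addr_ge0 ?sqr_ge0// lerDl sqr_ge0.
- by rewrite -sqrtr_sqr ler_sqrt ?addr_ge0 ?sqr_ge0// lerDr sqr_ge0.
- rewrite -[leRHS]ger0_norm ?addr_ge0// -sqrtr_sqr ler_sqrt ?sqr_ge0//.
  by rewrite sqrrD !real_normK ?num_real// lerD2r lerDl mulrn_wge0// mulr_ge0.
Qed.

Lemma ae_complex d (T : measurableType d) (R : realType)
    (mu : {measure set T -> \bar R}) (f g : T -> R[i]) :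
  {ae mu, forall t, complex.Re (f t) = complex.Re (g t)} ->
  {ae mu, forall t, complex.Im (f t) = complex.Im (g t)} ->
  {ae mu, forall t, f t = g t}.
Proof.
apply: filterS2 => t; case: (f t) (g t) => [? ?] [? ?] /=.
by move=> -> ->.
Qed.

Lemma cintegral_realM d (T : measurableType d) (R : realType)
    (mu : {measure set T -> \bar R}) (u : T -> R[i]) (h : T -> R) :
  cintegral mu (fun t => u t * (h t)%:C) =
  (\int[mu]_t (complex.Re (u t) * h t)) +i* (\int[mu]_t (complex.Im (u t) * h t)).
Proof.
rewrite /cintegral; congr (_ +i* _); apply: eq_Rintegral => t _;
  by case: (u t) => x y /=; rewrite mulr0 ?subr0 ?add0r.
Qed.

Section complex_primitive.
Context {R : realType} {a b x0 : R} (x0ab : x0 \in `]a, b[).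
Local Notation Omega := (interval_space x0ab).
Local Notation m := (interval_measure x0ab).
Local Notation val := (@interval_val R a b x0 x0ab).

(** The primitive of a complex function vanishing at the base point. *)
Definition cprimitive (w : Omega -> R[i]) (x : Omega) : R[i] :=
  cintegral m (fun t => w t * (anchor_kernel x0ab x t)%:C).

Lemma cprimitiveE w x : cprimitive w x =
  primitive x0ab (fun t => complex.Re (w t)) x +i* primitive x0ab (fun t => complex.Im (w t)) x.
Proof. exact: cintegral_realM. Qed.

Lemma cprimitive_base w : cprimitive w (base_point x0ab) = 0.
Proof.
rewrite cprimitiveE /primitive.
have k0 (v : Omega -> R) :
    \int[m]_t (v t * anchor_kernel x0ab (base_point x0ab) t) = 0.
  rewrite (_ : (fun t => _) = cst 0); first by rewrite Rintegral_cst// mul0r.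
  by apply/funext => t; rewrite /anchor_kernel/= subrr mulr0.
by rewrite !k0.
Qed.

(** Weak derivatives are computed separately on real and imaginary parts. *)
Lemma weak_derivativeP (u v : Omega -> R[i]) j : weak_derivative j u v <->
  forall phi, test_function a b phi ->
    \int[m]_t (complex.Re (u t) * derive1n j phi (val t)) =
      (-1) ^+ j * \int[m]_t (complex.Re (v t) * phi (val t)) /\
    \int[m]_t (complex.Im (u t) * derive1n j phi (val t)) =
      (-1) ^+ j * \int[m]_t (complex.Im (v t) * phi (val t)).
Proof.
have sgn (x y : R) : (-1) ^+ j * (x +i* y) = ((-1) ^+ j * x) +i* ((-1) ^+ j * y).
  rewrite (_ : (-1) ^+ j = ((-1) ^+ j)%:C); last by rewrite rmorphXn rmorphN rmorph1.
  by apply/eqP; rewrite eq_complex/= !mul0r subr0 addr0 !eqxx.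
split=> H phi tphi; have := H phi tphi.
  by rewrite !cintegral_realM sgn => -[].
by move=> [h1 h2]; rewrite !cintegral_realM sgn h1 h2.
Qed.

Lemma weak_derivative_cprimitive (c : R[i]) (v : Omega -> R[i]) :
  cintegrable m v -> weak_derivative 1 (fun t => c + cprimitive v t) v.
Proof.
move=> [ir ii]; apply/weak_derivativeP => phi tphi.
have real (k : R) (w : Omega -> R) : m.-integrable setT (EFin \o w) ->
    \int[m]_t ((k + primitive x0ab w t) * derive1n 1 phi (val t)) =
    (-1) ^+ 1 * \int[m]_t (w t * phi (val t)).
  move=> iw; rewrite expr1 mulN1r -(primitive_by_parts x0ab w phi iw tphi).
  have i1 := integrable_test1 x0ab phi 1 tphi.
  have ip := integrable_test x0ab _ phi 1 (integrable_primitive x0ab w iw) tphi.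
  transitivity (\int[m]_t (k * derive1n 1 phi (val t) +
      primitive x0ab w t * derive1n 1 phi (val t))).
    by apply: eq_Rintegral => t _; rewrite mulrDl.
  rewrite (RintegralD measurableT (integrable_mulr _ _ _ _ k _ i1) ip).
  rewrite (RintegralZl k measurableT i1) (integral_derive_test0 x0ab phi tphi).
  by rewrite mulr0 add0r.
split.
  rewrite -(real (complex.Re c) _ ir); apply: eq_Rintegral => t _.
  by rewrite cprimitiveE; case: c.
rewrite -(real (complex.Im c) _ ii); apply: eq_Rintegral => t _.
by rewrite cprimitiveE; case: c.
Qed.

Lemma weak_derivative1_primitive (u v : Omega -> R[i]) :
  cintegrable m u -> cintegrable m v -> weak_derivative 1 u v ->
  exists c, {ae m, forall t, u t = c + cprimitive v t}.
Proof.
move=> [ur ui] [vr vi] /weak_derivativeP H.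
have real (f g : Omega -> R) : m.-integrable setT (EFin \o f) ->
    m.-integrable setT (EFin \o g) -> (forall phi, test_function a b phi ->
     \int[m]_t (f t * derive1n 1 phi (val t)) =
      (-1) ^+ 1 * \int[m]_t (g t * phi (val t))) ->
   exists c, {ae m, forall t, f t = c + primitive x0ab g t}.
  move=> fi gi fg.
  have pgi := integrable_primitive x0ab g gi.
  have fpi : m.-integrable setT (EFin \o (fun t => f t - primitive x0ab g t)).
    exact: (integrableB measurableT fi pgi).
  have [|c fc] := du_bois_reymond x0ab _ fpi.
    move=> phi tphi.
    have h1 := integrable_test x0ab f phi 1 fi tphi.
    have h2 := integrable_test x0ab _ phi 1 pgi tphi.
    transitivity (\int[m]_t (f t * derive1n 1 phi (val t) -
        primitive x0ab g t * derive1n 1 phi (val t))).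
      by apply: eq_Rintegral => t _; rewrite mulrBl.
    rewrite (RintegralB measurableT h1 h2) (primitive_by_parts x0ab g phi gi tphi).
    by rewrite fg// expr1 mulN1r opprK addNr.
  exists c; move: fc; apply: filterS => t /eqP.
  by rewrite subr_eq => /eqP.
have [c1 h1] := real _ _ ur vr (fun phi tphi => (H phi tphi).1).
have [c2 h2] := real _ _ ui vi (fun phi tphi => (H phi tphi).2).
by exists (c1 +i* c2); apply: ae_complex;
  [move: h1|move: h2]; apply: filterS => t; rewrite cprimitiveE.
Qed.

Lemma weak_derivative_unique j (u v v' : Omega -> R[i]) :
  cintegrable m v -> cintegrable m v' ->
  weak_derivative j u v -> weak_derivative j u v' ->
  {ae m, forall t, v t = v' t}.
Proof.
move=> [vr vi] [vr' vi'] /weak_derivativeP H /weak_derivativeP H'.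
have real (f g : Omega -> R) : m.-integrable setT (EFin \o f) ->
    m.-integrable setT (EFin \o g) -> (forall phi, test_function a b phi ->
     (-1) ^+ j * \int[m]_t (f t * phi (val t)) =
     (-1) ^+ j * \int[m]_t (g t * phi (val t))) ->
    {ae m, forall t, f t = g t}.
  move=> fi gi fg.
  have fgi : m.-integrable setT (EFin \o (fun t => f t - g t)).
    exact: (integrableB measurableT fi gi).
  suff : {ae m, forall t, f t - g t = 0}.
    by apply: filterS => t /eqP; rewrite subr_eq0 => /eqP.
  apply: (fundamental_lemma x0ab _ fgi) => phi tphi.
  have h1 := integrable_test x0ab f phi 0 fi tphi.
  have h2 := integrable_test x0ab g phi 0 gi tphi.
  transitivity (\int[m]_t (f t * phi (val t) - g t * phi (val t))).
    by apply: eq_Rintegral => t _; rewrite mulrBl.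
  rewrite (RintegralB measurableT h1 h2).
  have /mulfI -> := fg phi tphi; first by rewrite subrr.
  by rewrite signr_eq0.
apply: ae_complex; apply: real => // phi tphi.
  by rewrite -(H phi tphi).1 -(H' phi tphi).1.
by rewrite -(H phi tphi).2 -(H' phi tphi).2.
Qed.

End complex_primitive.

(** * Absolutely continuous representatives *)

Section ac_representatives.
Context {R : realType} {a b x0 : R} (x0ab : x0 \in `]a, b[).
Local Notation Omega := (interval_space x0ab).
Local Notation m := (interval_measure x0ab).
Local Notation val := (@interval_val R a b x0 x0ab).

Lemma primitive_itv (v : Omega -> R) (s t : Omega) :
  m.-integrable setT (EFin \o v) -> val s <= val t ->
  primitive x0ab v t - primitive x0ab v s =
  \int[m]_r (v r * itv_indicator x0ab s t r).
Proof.
move=> iv st.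
have it := integrable_anchor_kernel x0ab v t iv.
have is_ := integrable_anchor_kernel x0ab v s iv.
rewrite /primitive -(RintegralB measurableT it is_).
apply: eq_Rintegral => r _; rewrite -mulrBr; congr (_ * _).
rewrite /anchor_kernel /itv_indicator opprB addrA subrK.
have [rs|sr] := ltP (val r) (val s).
  by rewrite (lt_le_trans rs st)/= subrr.
by rewrite subr0.
Qed.

Lemma cprimitive_ac (c : R[i]) (w : Omega -> R[i]) : cintegrable m w ->
  absolutely_continuous (fun t => c + cprimitive x0ab w t).
Proof.
move=> [ir ii] e e0.
pose g r := `|complex.Re (w r)| + `|complex.Im (w r)|.
have ig : m.-integrable setT (EFin \o g).
  exact: (integrableD measurableT (integrable_norm ir) (integrable_norm ii)).
have [|d d0 H] := integral_absolutely_continuous x0ab g ig _ e e0.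
  by move=> t; rewrite addr_ge0.
exists d => // n s t st dis sd.
apply: le_lt_trans (H n s t st dis sd); apply: ler_sum => i _.
have iJ (f : Omega -> R) : m.-integrable setT (EFin \o f) ->
    m.-integrable setT (EFin \o (fun r => f r * itv_indicator x0ab (s i) (t i) r)).
  move=> fi; apply: (integrable_mulr_bounded _ _ _ _ _ _ 1 fi).
    exact: measurable_itv_indicator.
  exact: itv_indicator_le1.
have bnd (f : Omega -> R) : m.-integrable setT (EFin \o f) ->
    `|primitive x0ab f (t i) - primitive x0ab f (s i)| <=
    \int[m]_r (`|f r| * itv_indicator x0ab (s i) (t i) r).
  move=> fi; rewrite (primitive_itv f _ _ fi (st i)).
  apply: (le_trans (le_normr_Rintegral measurableT (iJ f fi))).
  apply: (le_Rintegral measurableT (integrable_norm (iJ f fi))).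
    exact: iJ (integrable_norm fi).
  by move=> r _; rewrite /= normrM [X in _ * X]ger0_norm// ler0n.
rewrite opprD addrACA subrr add0r.
have [_ _ /le_trans] := normc_bounds (cprimitive x0ab w (t i) - cprimitive x0ab w (s i)).
apply; rewrite !cprimitiveE /=.
apply: (le_trans (lerD (bnd _ ir) (bnd _ ii))).
rewrite -(RintegralD measurableT (iJ _ (integrable_norm ir)) (iJ _ (integrable_norm ii))).
rewrite le_eqVlt; apply/orP; left; apply/eqP.
by apply: eq_Rintegral => r _; rewrite /g mulrDl.
Qed.

(** A property holding almost everywhere holds somewhere in every nonempty
    open subinterval. *)
Lemma ae_itv_ex (P : Omega -> Prop) (c d : R) : {ae m, forall t, P t} ->
  a <= c -> c < d -> d <= b -> exists t, c < val t < d /\ P t.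
Proof.
move=> [N [mN N0 PN]] ac cd db; apply: contrapT => H.
have sub : val @^-1` `]c, d[ `<=` N.
  move=> t /=; rewrite in_itv/= => tcd; apply: PN => /= Pt; apply: H.
  by exists t.
have mI : measurable (`]c, d[%classic : set R) by exact: measurable_itv.
have mV := measurable_val_preimage x0ab _ mI.
have : (m (val @^-1` `]c, d[) <= m N)%E by apply: le_measure => //; rewrite inE.
rewrite N0 (interval_measure_preimage x0ab `]c, d[%classic) setIidl.
  by rewrite lebesgue_measure_itv/= lte_fin cd -EFinB lee_fin subr_le0 leNgt cd.
move=> x /=; rewrite !in_itv/= => /andP[cx xd].
by rewrite (le_lt_trans ac cx) (lt_le_trans xd db).
Qed.

Lemma normc_sym (z w : R[i]) : normc (z - w) = normc (w - z).
Proof. by rewrite -opprB normcN. Qed.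

Lemma ac_continuous (u : Omega -> R[i]) : absolutely_continuous u ->
  forall e : R, 0 < e -> exists2 d : R, 0 < d &
    forall x y, `|val x - val y| < d -> normc (u x - u y) < e.
Proof.
move=> acu e e0; have [d d0 H] := acu e e0; exists d => // x y xyd.
have H1 s t : val s <= val t -> val t - val s < d -> normc (u t - u s) < e.
  move=> st sd; have := H 1%N (fun=> s) (fun=> t); rewrite !big_ord1; apply => //.
  by move=> i j; rewrite (ord1 i) (ord1 j).
have [xy|/ltW yx] := leP (val x) (val y).
  by rewrite normc_sym; apply: H1 => //; rewrite (le_lt_trans _ xyd)// distrC ler_norm.
by apply: H1 => //; rewrite (le_lt_trans _ xyd)// ler_norm.
Qed.

Lemma ac_ae_unique (u1 u2 : Omega -> R[i]) : absolutely_continuous u1 ->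
  absolutely_continuous u2 -> {ae m, forall t, u1 t = u2 t} -> u1 = u2.
Proof.
move=> ac1 ac2 u12; apply/funext => x; apply/eqP; rewrite -subr_eq0.
apply/eqP/eq0_normc/eqP; rewrite eq_le normc_ge0 andbT leNgt; apply/negP => e0.
set e := normc _ in e0.
have e2 : 0 < e / 2 by rewrite divr_gt0.
have [d1 d10 H1] := ac_continuous u1 ac1 _ e2.
have [d2 d20 H2] := ac_continuous u2 ac2 _ e2.
have /andP[ax xb] := interval_val_itv x0ab x.
(* A point t close to x at which both functions agree. *)
have [|||t [/andP[t1 t2] ut]] := ae_itv_ex _ (val x) (Num.min b (val x + Num.min d1 d2)) u12.
- exact: ltW.
- by rewrite lt_min xb ltrDl lt_min d10.
- by rewrite ge_min lexx.
move: t2; rewrite lt_min -ltrBlDl lt_min => /andP[_ /andP[td1 td2]].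
have tx : `|val x - val t| = val t - val x by rewrite distrC ger0_norm// subr_ge0 ltW.
have := ltrD (H1 x t _) (H2 t x _); rewrite tx distrC tx -splitr => /(_ td1 td2).
rewrite ltNge => /negP; apply.
by rewrite /e (le_trans _ (le_normcD _ _))// ut addrA subrK.
Qed.

Lemma ac_representative_base (p : \bar R) (p1 : (1 <= p)%E) (v : Lp m p1) c w :
  cintegrable m w -> {ae m, forall t, v t = c + cprimitive x0ab w t} ->
  ac_representative v (base_point x0ab) = c.
Proof.
move=> iw vE; rewrite /ac_representative.
rewrite (_ : xget _ _ = (fun t => c + cprimitive x0ab w t)).
  by rewrite cprimitive_base addr0.
have acw := cprimitive_ac c w iw.
apply: xget_unique.
  by split => //; move: vE; apply: filterS => t ->.
move=> u [acu uv]; apply: ac_ae_unique => //.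
by move: uv vE; apply: filterS2 => t -> ->.
Qed.

Lemma Lp_cintegrable (p : \bar R) (p1 : (1 <= p)%E) (u : Lp m p1) : cintegrable m u.
Proof.
have [[mr mi] lu] := LpP u; have mnu := measurable_normc (conj mr mi).
have Lu : (@normc R \o u) \in Lfun m p by apply/andP; split; exact: mem_set.
have fin : m setT \is a fin_num by rewrite ge0_fin_numE ?interval_measure_fin.
have /Lfun1_integrable iu := Lfun_subset (lexx 1%E) p1 fin p1 Lu.
split; apply: (le_integrable measurableT _ _ iu); try exact/measurable_EFinP;
  move=> t _; rewrite /= lee_fin [leRHS]ger0_norm ?normc_ge0//;
  by have [] := normc_bounds (u t).
Qed.

Lemma cmeasurable_cprimitive c w : cintegrable m w ->
  cmeasurable (fun t => c + cprimitive x0ab w t).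
Proof.
move=> [ir ii]; split.
  rewrite (_ : (fun t => _) = (fun t => complex.Re c + primitive x0ab (fun t => complex.Re (w t)) t)).
    exact: (measurable_funD (measurable_cst _) (measurable_primitive x0ab _ ir)).
  by apply/funext => t; rewrite cprimitiveE; case: c.
rewrite (_ : (fun t => _) = (fun t => complex.Im c + primitive x0ab (fun t => complex.Im (w t)) t)).
  exact: (measurable_funD (measurable_cst _) (measurable_primitive x0ab _ ii)).
by apply/funext => t; rewrite cprimitiveE; case: c.
Qed.

Lemma bounded_cLfun (p : \bar R) (p1 : (1 <= p)%E) (f : Omega -> R[i]) (M : R) :
  cmeasurable f -> (forall t, normc (f t) <= M) -> f \in cLfun m p1.
Proof.
move=> mf fM; rewrite inE; split => //.
apply: (@le_lt_trans _ _ ('N[m]_p[EFin \o cst M])%E).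
  apply: (le_cLnorm m p1 (measurable_normc mf) (measurable_cst _)).
  by move=> t; rewrite normc_ge0 fM.
case: p p1 => [r||//] r1.
  by have := Lfun_cst m M r; rewrite inE/= => /andP[_]; rewrite inE.
rewrite unlock /Lnorm interval_measure_gt0.
apply: (@le_lt_trans _ _ `|M|%:E); last exact: ltry.
by apply/ess_supP; apply: nearW => t /=.
Qed.

Lemma cprimitive_cLfun (p : \bar R) (p1 : (1 <= p)%E) c w : cintegrable m w ->
  (fun t => c + cprimitive x0ab w t) \in cLfun m p1.
Proof.
move=> iw; apply: (bounded_cLfun p p1 _ (normc c + (\int[m]_t `|complex.Re (w t)| +
  \int[m]_t `|complex.Im (w t)|))).
  exact: cmeasurable_cprimitive.
move=> t; apply: (le_trans (le_normcD _ _)); rewrite lerD2l.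
have [_ _ /le_trans] := normc_bounds (cprimitive x0ab w t).
by apply; rewrite cprimitiveE/= lerD// primitive_bounded//; case: iw.
Qed.

End ac_representatives.

(** * Taylor's formula in the Sobolev space *)

Lemma Lp_eq_ae d (T : measurableType d) (R : realType)
    (mu : {measure set T -> \bar R}) (p : \bar R) (p1 : (1 <= p)%E) (x y : Lp mu p1) :
  {ae mu, forall t, x t = y t} -> x = y.
Proof.
elim/Lp_ind: x => f; elim/Lp_ind: y => g fg; apply: eq_Lp_class.
have := ae_Lp_class f; have := ae_Lp_class g; move: fg.
by apply: filterS3 => t fg gE fE; rewrite -fE -gE.
Qed.

Section sobolev_theory.
Context {R : realType} {a b x0 : R} (x0ab : x0 \in `]a, b[).
Context {p : \bar R} (p1 : (1 <= p)%E) (k : nat).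
Local Notation Omega := (interval_space x0ab).
Local Notation m := (interval_measure x0ab).
Local Notation val := (@interval_val R a b x0 x0ab).
Local Notation LpOmega := (Lp m p1).
Local Notation W := (sobolev_space x0ab p1 k).

Lemma weak_derivative_ae j (u u' v v' : Omega -> R[i]) :
  cmeasurable u -> cmeasurable u' -> cmeasurable v -> cmeasurable v' ->
  {ae m, forall t, u t = u' t} -> {ae m, forall t, v t = v' t} ->
  weak_derivative j u v -> weak_derivative j u' v'.
Proof.
move=> mu mu' mv mv' uu' vv' H phi tphi.
have := H phi tphi.
have E (f g : Omega -> R[i]) n : cmeasurable f -> cmeasurable g ->
    {ae m, forall t, f t = g t} ->
    cintegral m (fun t : Omega => f t * (derive1n n phi (val t))%:C) =
    cintegral m (fun t : Omega => g t * (derive1n n phi (val t))%:C).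
  move=> mf mg fg; have mphi := measurable_derive1n (x0ab := x0ab) n tphi.
  apply: (ae_eq_cintegral (cmeasurableMr mf mphi) (cmeasurableMr mg mphi)).
  by move: fg; apply: filterS => t ->.
by rewrite (E _ _ j mu mu' uu') (E _ _ 0 mv mv' vv').
Qed.

Lemma weak_derivative_comp j (u v w : Omega -> R[i]) :
  weak_derivative j u v -> weak_derivative 1 v w -> weak_derivative j.+1 u w.
Proof.
move=> uv vw phi tphi; have ab := interval_lt x0ab.
have := uv _ (test_function_derive _ _ 1 _ ab tphi).
under eq_fun do rewrite /derive1n -iterD addn1.
by move=> ->; rewrite (vw _ tphi) mulrA -exprD addn1.
Qed.

(** The weak derivative of order [j.+1] is the weak derivative of that of
    order [j]: test against [phi']. *)
Lemma weak_derivative_step j (u v w : Omega -> R[i]) :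
  weak_derivative j u v -> weak_derivative j.+1 u w -> weak_derivative 1 v w.
Proof.
move=> uv uw phi tphi; have ab := interval_lt x0ab.
have := uv _ (test_function_derive _ _ 1 _ ab tphi).
under eq_fun do rewrite /derive1n -iterD addn1.
rewrite (uw _ tphi) exprSr -mulrA expr1 => /mulfI <-//.
by rewrite signr_eq0.
Qed.

Lemma weak_derivative0 (u : Omega -> R[i]) : weak_derivative 0 u u.
Proof. by move=> phi _; rewrite expr0 mul1r. Qed.

Lemma weak_derivative_sobolev (f : W) j : (j <= k)%N ->
  weak_derivative j f (sobolev_derivative j f).
Proof.
rewrite /sobolev_derivative; case: eqVneq => [->|j0] jk.
  exact: weak_derivative0.
apply: (@xgetPex _ 0 [set v : LpOmega | weak_derivative j (f : LpOmega) v]).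
by have := valP f; rewrite inE; apply; rewrite lt0n j0.
Qed.

Lemma sobolev_derivative_unique (f : W) j (v : LpOmega) : (j <= k)%N ->
  weak_derivative j f v -> sobolev_derivative j f = v.
Proof.
move=> jk fv; apply: Lp_eq_ae.
exact: (weak_derivative_unique x0ab j f _ _ (Lp_cintegrable _ _ _ _) (Lp_cintegrable _ _ _ _)
  (weak_derivative_sobolev f j jk) fv).
Qed.

Lemma sobolev_derivative_linear j (c : R[i]) (f g : W) : (j <= k)%N ->
  sobolev_derivative j (c *: f + g) =
  c *: sobolev_derivative j f + sobolev_derivative j g.
Proof.
move=> jk; apply: sobolev_derivative_unique => //.
exact: (weak_derivative_linear c (weak_derivative_sobolev f j jk)
  (weak_derivative_sobolev g j jk)).
Qed.

Lemma cintegrable_kernel (w : Omega -> R[i]) x : cintegrable m w ->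
  cintegrable m (fun t => w t * (anchor_kernel x0ab x t)%:C).
Proof.
move=> [ir ii]; split.
  rewrite (_ : (fun t => _) = EFin \o (fun t => complex.Re (w t) * anchor_kernel x0ab x t)).
    exact: integrable_anchor_kernel.
  by apply/funext => t /=; case: (w t) => ? ? /=; rewrite mulr0 subr0.
rewrite (_ : (fun t => _) = EFin \o (fun t => complex.Im (w t) * anchor_kernel x0ab x t)).
  exact: integrable_anchor_kernel.
by apply/funext => t /=; case: (w t) => ? ? /=; rewrite mulr0 add0r.
Qed.

Lemma cprimitive_linear c (u v : LpOmega) x :
  cprimitive x0ab (Lp_repr (c *: u + v)) x =
  c * cprimitive x0ab u x + cprimitive x0ab v x.
Proof.
have iu := Lp_cintegrable x0ab p p1 u; have iv := Lp_cintegrable x0ab p p1 v.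
rewrite /cprimitive -(cintegral_linear c (cintegrable_kernel u x iu) (cintegrable_kernel v x iv)).
have mk := measurable_anchor_kernel2 x0ab x.
apply: ae_eq_cintegral.
- exact: (cmeasurableMr (proj1 (LpP (c *: u + v))) mk).
- apply: (cmeasurableD (cmeasurableZ c (cmeasurableMr (proj1 (LpP u)) mk))).
  exact: (cmeasurableMr (proj1 (LpP v)) mk).
- have := ae_Lp_linear c u v; apply: filterS => t ->.
  by rewrite mulrDl mulrA.
Qed.

(** Taylor's formula of order one for the weak derivatives of order less
    than [k]. *)
Lemma sobolev_taylor (f : W) j : (j < k)%N ->
  {ae m, forall t, sobolev_derivative j f t =
    anchor_value j f + cprimitive x0ab (sobolev_derivative j.+1 f) t}.
Proof.
move=> jk.
have [c H] := weak_derivative1_primitive x0ab _ _ (Lp_cintegrable x0ab p p1 (sobolev_derivative j f))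
  (Lp_cintegrable x0ab p p1 (sobolev_derivative j.+1 f))
  (weak_derivative_step _ _ _ _ (weak_derivative_sobolev f j (ltnW jk))
     (weak_derivative_sobolev f j.+1 jk)).
by rewrite /anchor_value (ac_representative_base x0ab p p1 _ c _ (Lp_cintegrable x0ab p p1 _) H).
Qed.

(** The anchor value is characterized as the integration constant in
    [sobolev_taylor]. *)
Lemma anchor_value_unique (f : W) j c : (j < k)%N ->
  {ae m, forall t, sobolev_derivative j f t =
    c + cprimitive x0ab (sobolev_derivative j.+1 f) t} -> anchor_value j f = c.
Proof.
by move=> jk H; exact: (ac_representative_base x0ab p p1 _ c _ (Lp_cintegrable x0ab p p1 _) H).
Qed.

Lemma anchor_value_linear j (c : R[i]) (f g : W) : (j < k)%N ->
  anchor_value j (c *: f + g) = c * anchor_value j f + anchor_value j g.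
Proof.
move=> jk; apply: anchor_value_unique => //.
rewrite !sobolev_derivative_linear// 1?ltnW//.
have := ae_Lp_linear c (sobolev_derivative j f) (sobolev_derivative j g).
have := sobolev_taylor f j jk; have := sobolev_taylor g j jk.
apply: filterS3 => t gt ft ->.
by rewrite ft gt cprimitive_linear mulrDr addrACA.
Qed.

(** A function is real as soon as its [k]-th derivative and its values at the
    base point are: by Taylor's formula, so are its derivatives, from order [k]
    down to order [0]. *)
Lemma sobolev_real (f : W) :
  {ae m, forall t, complex.Im (sobolev_derivative k f t) = 0} ->
  (forall j, (j < k)%N -> complex.Im (anchor_value j f) = 0) ->
  {ae m, forall t, complex.Im (Lp_repr f t) = 0}.
Proof.
move=> Imk Im0.
(* Descending induction on the order of derivation k - i. *)
suff H i : (i <= k)%N ->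
    {ae m, forall t, complex.Im (sobolev_derivative (k - i) f t) = 0}.
  by have := H k (leqnn k); rewrite subnn.
elim: i => [_|i IH ik]; first by rewrite subn0.
have kj : (k - i.+1).+1 = (k - i)%N by rewrite subnSK.
have jk : (k - i.+1 < k)%N by rewrite kj leq_subr.
have := sobolev_taylor f _ jk; apply: filterS => t ->.
rewrite cprimitiveE raddfD /= (Im0 _ jk) add0r kj /primitive.
transitivity (\int[m]_(r in [set: Omega]) (0 : R)); last by rewrite Rintegral_cst// mul0r.
congr fine; apply: ae_eq_integral.
- exact: measurableT.
- exact: (measurable_int _ (integrable_anchor_kernel x0ab _ t
    (proj2 (Lp_cintegrable x0ab p p1 (sobolev_derivative (k - i) f))))).
- exact: measurable_cst.
- by move: (IH (ltnW ik)); apply: filterS => r -> _; rewrite mul0r.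
Qed.

(** Integrating [n] times, with integration constants [c]. *)
Lemma iterated_primitive n (c : nat -> R[i]) (g : LpOmega) :
  exists V : nat -> LpOmega, V n = g /\ forall j, (j < n)%N ->
    {ae m, forall t, V j t = c j + cprimitive x0ab (V j.+1) t}.
Proof.
elim: n c => [|n IH] c; first by exists (fun=> g).
have [V [Vn HV]] := IH (fun j => c j.+1).
pose u := Lp_class (CLfun (cprimitive_cLfun x0ab p p1 (c 0%N) _
  (Lp_cintegrable x0ab p p1 (V 0%N)))).
exists (fun j => if j is i.+1 then V i else u); split => // -[_|j jn].
  exact: ae_Lp_class.
exact: HV.
Qed.

Lemma sobolev_surjective (c : nat -> R[i]) (g : LpOmega) :
  exists f : W, sobolev_derivative k f = g /\
    forall j, (j < k)%N -> anchor_value j f = c j.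
Proof.
have [V [Vk HV]] := iterated_primitive k c g.
have wV j : (j <= k)%N -> weak_derivative j (V 0%N) (V j).
  elim: j => [_|j IH jk]; first exact: weak_derivative0.
  apply: (weak_derivative_comp _ _ _ _ (IH (ltnW jk))).
  have ic := Lp_cintegrable x0ab p p1 (V j.+1).
  have mV i : cmeasurable (V i) := proj1 (LpP (V i)).
  apply: (weak_derivative_ae 1 _ _ _ _ (cmeasurable_cprimitive x0ab (c j) _ ic)
    (mV j) (mV j.+1) (mV j.+1) _ _ (weak_derivative_cprimitive x0ab (c j) _ ic)).
    by move: (HV j jk); apply: filterS => t ->.
  exact: aeW.
have VW : V 0%N \in sobolev k.
  by rewrite inE => j /andP[_ jk]; exists (V j); exact: wV.
have dV j : (j <= k)%N -> sobolev_derivative j (SobolevFun VW) = V j.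
  by move=> jk; apply: sobolev_derivative_unique => //; exact: wV.
exists (SobolevFun VW); split; first by rewrite dV.
move=> j jk; apply: anchor_value_unique => //.
by rewrite (dV _ jk) (dV _ (ltnW jk)); exact: HV.
Qed.

End sobolev_theory.

(** * The space with atoms *)

Lemma measurable_normc_poweR d (T : measurableType d) (R : realType)
    (f : T -> R[i]) (r : R) : cmeasurable f ->
  measurable_fun setT (fun x => (`|(normc (f x))%:E| `^ r)%E).
Proof.
move=> /measurable_normc/measurable_EFinP mf.
exact: (measurableT_comp (measurable_poweR r) (measurableT_comp (@abse_measurable R setT) mf)).
Qed.

Section anchored_theory.
Context {R : realType} {a b x0 : R} (x0ab : x0 \in `]a, b[) (k : nat).
Local Notation Omega := (interval_space x0ab).
Local Notation m := (interval_measure x0ab).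
Local Notation X := (anchored_space x0ab k).
Local Notation mu := (anchored_measure x0ab k).
Local Notation inO := (inr : Omega -> X).
Local Notation inA := (inl : 'I_k -> X).

Lemma measurable_inr : measurable_fun setT inO.
Proof. by move=> _ A mA; rewrite setTI. Qed.

(** Measurability on the enlarged space only concerns the interval. *)
Lemma measurable_anchored d (Y : measurableType d) (f : X -> Y) :
  measurable_fun setT (fun t : Omega => f (inr t)) -> measurable_fun setT f.
Proof. by move=> mf _ B mB; rewrite setTI; have := mf measurableT B mB; rewrite setTI. Qed.

(** Each atom has mass one, so that no atom can be excepted. *)
Lemma ae_anchored (P : X -> Prop) : {ae mu, forall x, P x} <->
  (forall j, P (inA j)) /\ {ae m, forall t, P (inO t)}.
Proof.
split=> [[N [mN N0 PN]]|[PA [N [mN N0 PN]]]].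
  have part0 : m (inO @^-1` N) = 0%E.
    by apply/eqP; rewrite eq_le measure_ge0 andbT -[leRHS]N0 leeDl// sume_ge0.
  split=> [j|].
    apply: contrapT => nP; have Nj : N (inA j) by exact: PN.
    have : (\sum_(i < k) \d_(inA i) N <= 0 :> \bar R)%E.
      by rewrite -[leRHS]N0 /anchored_measure leeDr// measure_ge0.
    rewrite (bigD1 j)//= diracE mem_set// => H.
    suff : (1 <= 0 :> \bar R)%E by rewrite lee_fin ler10.
    by apply: le_trans H; rewrite leeDl// sume_ge0.
  by exists (inO @^-1` N); split => // t /PN.
exists [set x : X | if x is inr t then N t else False]; split => //.
  rewrite /anchored_measure [X in (X + _)%E]N0 add0e big1// => j _.
  by rewrite diracE memNset.
by move=> [j|t] /=; [move=> /(_ (PA j))|exact: PN].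
Qed.

Lemma ge0_integral_anchored (h : X -> \bar R) : measurable_fun setT h ->
  (forall x, 0 <= h x)%E ->
  (\int[mu]_x h x = \sum_(j < k) h (inA j) + \int[m]_t h (inO t))%E.
Proof.
move=> mh h0.
pose md (n : nat) : {measure set X -> \bar R} :=
  if insub n is Some j then [the measure _ _ of \d_(inA j)] else [the measure _ _ of mzero].
have mdE (j : 'I_k) : md j = [the measure _ _ of \d_(inA j)] by rewrite /md valK.
rewrite (@eq_measure_integral _ _ _ _
  (measure_add [the measure _ _ of @interval_part R a b x0 x0ab k] [the measure _ _ of msum md k])).
  rewrite ge0_integral_measure_add// ge0_integral_measure_sum//.
  rewrite addeC; congr (_ + _)%E.
    apply: eq_bigr => j _; rewrite mdE integral_dirac//.
    by rewrite diracT mul1e.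
  exact: (ge0_integral_pushforward measurable_inr m measurableT).
move=> A mA _; transitivity (interval_part A + msum md k A)%E.
  by congr (_ + _)%E; apply: eq_bigr => j _; rewrite mdE.
exact/esym/measure_addE.
Qed.

Lemma anchored_measure_gt0 : (0 < mu setT)%E.
Proof.
apply: (lt_le_trans (interval_measure_gt0 x0ab)).
by rewrite /anchored_measure/= /interval_part preimage_setT leeDl// sume_ge0.
Qed.

Lemma cmeasurable_anchored (F : X -> R[i]) :
  cmeasurable (fun t : Omega => F (inr t)) -> cmeasurable F.
Proof. by move=> [mr mi]; split; exact: measurable_anchored. Qed.

Lemma cLnorm_anchored (p : \bar R) (F : X -> R[i]) (N : R) : (1 <= p)%E ->
  cmeasurable (fun t : Omega => F (inr t)) ->
  cLnorm m p (fun t : Omega => F (inr t)) = N%:E ->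
  cLnorm mu p F = (if p is r%:E then
      (\sum_(j < k) normc (F (inA j)) `^ r + N `^ r) `^ r^-1
    else Num.max (\big[Num.max/0]_(j < k) normc (F (inA j))) N)%:E.
Proof.
move=> p1 mF; have mX := measurable_normc (cmeasurable_anchored F mF).
case: p p1 => [r||//] p1 NE.
  have r0 : r != 0.
    by rewrite gt_eqF// (lt_le_trans ltr01)// -lee_fin.
  have mr := measurable_normc_poweR _ _ _ F r (cmeasurable_anchored F mF).
  rewrite /cLnorm unlock ge0_integral_anchored//; last first.
    by move=> x; exact: poweR_ge0.
  have := poweR_Lnorm m (EFin \o (@normc R \o (fun t : Omega => F (inr t)))) r0.
  rewrite -/(cLnorm _ _ _) NE => <-.
  rewrite poweR_EFin (eq_bigr (fun j => (normc (F (inA j)) `^ r)%:E)); last first.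
    by move=> j _; rewrite /= ger0_norm ?normc_ge0// poweR_EFin.
  by rewrite sumEFin -EFinD poweR_EFin.
have N0 : 0 <= N by rewrite -lee_fin -NE Lnorm_ge0.
move: NE; rewrite /cLnorm unlock /Lnorm anchored_measure_gt0 interval_measure_gt0 => NE.
set S := ess_sup _ _.
apply/eqP; rewrite eq_le; apply/andP; split.
  apply/ess_supP/ae_anchored; split=> [j|].
    rewrite /= ger0_norm ?normc_ge0// lee_fin le_max.
    by rewrite (le_bigmax _ (fun j => normc (F (inA j)))).
  have := @ess_sup_ge _ _ _ m (abse \o (EFin \o (@normc R \o (fun t : Omega => F (inr t))))).
  rewrite NE; apply: filterS => t /= /le_trans; apply.
  by rewrite lee_fin le_max lexx orbT.
have : {ae mu, forall x, (abse \o (EFin \o (@normc R \o F))) x <= S}%E by exact: ess_sup_ge.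
move=> /ae_anchored[SA SO].
have NS : (N%:E <= S)%E by rewrite -NE; apply/ess_supP.
rewrite EFin_max ge_max NS andbT.
apply: (big_ind (fun x : R => (x%:E <= S)%E)).
- by apply: le_trans NS; rewrite lee_fin.
- by move=> x y xS yS; rewrite EFin_max ge_max xS.
- by move=> j _; have := SA j; rewrite /= ger0_norm ?normc_ge0.
Qed.

Lemma cLnorm_inr_le (p : \bar R) (F : X -> R[i]) : (1 <= p)%E ->
  cmeasurable F ->
  (cLnorm m p (fun t : Omega => F (inr t)) <= cLnorm mu p F)%E.
Proof.
move=> p1 mF; rewrite /cLnorm unlock /Lnorm; case: p p1 => [r||//] p1.
  have r0 : 0 <= r by rewrite -lee_fin (le_trans _ p1)// lee_fin.
  have h0 (x : X) : (0 <= `|(normc (F x))%:E| `^ r)%E by exact: poweR_ge0.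
  apply: gt0_ler_poweR; rewrite ?invr_ge0//.
  - by rewrite in_itv/= leey andbT integral_ge0.
  - by rewrite in_itv/= leey andbT integral_ge0.
  - rewrite (ge0_integral_anchored _ (measurable_normc_poweR _ _ _ F r mF) h0).
    by rewrite leeDr// sume_ge0.
rewrite anchored_measure_gt0 interval_measure_gt0; apply/ess_supP.
set S := ess_sup _ _.
have : {ae mu, forall x, (abse \o (EFin \o (@normc R \o F))) x <= S}%E by exact: ess_sup_ge.
by move=> /ae_anchored[].
Qed.

End anchored_theory.

Lemma cLnorm_ae d (T : measurableType d) (R : realType)
    (mu : {measure set T -> \bar R}) (p : \bar R) (f g : T -> R[i]) :
  (1 <= p)%E -> cmeasurable f -> cmeasurable g ->
  {ae mu, forall t, f t = g t} -> cLnorm mu p f = cLnorm mu p g.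
Proof.
move=> p1 mf mg fg; rewrite /cLnorm unlock /Lnorm.
case: p p1 => [r||//] _; last first.
  by case: ifP => // _; apply: eq_ess_sup; move: fg; apply: filterS => t /= ->.
congr (_ `^ _)%E; apply: ae_eq_integral.
- exact: measurableT.
- exact: measurable_normc_poweR.
- exact: measurable_normc_poweR.
- by move: fg; apply: filterS => t /= -> _.
Qed.

(** * The isomorphism *)

Section isomorphism.
Context {R : realType} {p : \bar R} (p1 : (1 <= p)%E) (k : nat).
Context {a b x0 : R} (x0ab : x0 \in `]a, b[).
Local Notation Omega := (interval_space x0ab).
Local Notation m := (interval_measure x0ab).
Local Notation X := (anchored_space x0ab k).
Local Notation mu := (anchored_measure x0ab k).
Local Notation W := (sobolev_space x0ab p1 k).
Local Notation LpX := (Lp mu p1).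

(** The function on the enlarged space given by its values [c] at the atoms
    and its restriction [w] to the interval. *)
Definition glue (c : 'I_k -> R[i]) (w : Omega -> R[i]) (x : X) : R[i] :=
  match x with inl j => c j | inr t => w t end.

Lemma glue_cLfun c (w : Lp m p1) : glue c w \in cLfun mu p1.
Proof.
have [mw wfin] := LpP w.
rewrite inE; split; first exact: cmeasurable_anchored.
have wE : cLnorm m p w = (Lp_norm m p1 w)%:E.
  by rewrite /Lp_norm fineK// ge0_fin_numE ?Lnorm_ge0.
by rewrite (cLnorm_anchored x0ab k p (glue c w) _ p1 mw wE) ltry.
Qed.

(** The isomorphism: the anchor values at the atoms and the [k]-th derivative
    on the interval. *)
Definition anchored_data (f : W) : LpX :=
  Lp_class (CLfun (glue_cLfun (fun j => anchor_value j f) (sobolev_derivative k f))).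

Lemma anchored_dataP (f : W) : {ae mu, forall x, anchored_data f x =
  glue (fun j => anchor_value j f) (sobolev_derivative k f) x}.
Proof. exact: ae_Lp_class. Qed.

Lemma anchored_data_linear : linear anchored_data.
Proof.
move=> c f g; rewrite /anchored_data -[c *: Lp_class _]/(Lp_scale c _).
rewrite Lp_class_scale Lp_classD; apply: eq_Lp_class; apply/ae_anchored; split=> [j|].
  exact: anchor_value_linear.
rewrite /= sobolev_derivative_linear//.
exact: (ae_Lp_linear c (sobolev_derivative k f) (sobolev_derivative k g)).
Qed.

HB.instance Definition _ := GRing.isLinear.Build R[i] W LpX _ anchored_data
  anchored_data_linear.

Lemma anchored_data_norm (f : W) :
  Lp_norm mu p1 (anchored_data f) = sobolev_norm x0ab p1 k f.
Proof.
rewrite /Lp_norm (cLnorm_ae _ _ _ mu p _ _ p1 (proj1 (LpP (anchored_data f))) _ (anchored_dataP f)).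
  have [mw wfin] := LpP (sobolev_derivative k f).
  have wE : cLnorm m p (sobolev_derivative k f) = (Lp_norm m p1 (sobolev_derivative k f))%:E.
    by rewrite /Lp_norm fineK// ge0_fin_numE ?Lnorm_ge0.
  by rewrite (cLnorm_anchored x0ab k p (glue _ _) _ p1 mw wE).
apply: cmeasurable_anchored; exact: (proj1 (LpP (sobolev_derivative k f))).
Qed.

Lemma anchored_data_surjective (y : LpX) : exists f : W, anchored_data f = y.
Proof.
have [[mr mi] yfin] := LpP y.
have my : cmeasurable (fun t : Omega => y (inr t)).
  by split; [exact: (measurableT_comp mr (measurable_inr x0ab k))
            |exact: (measurableT_comp mi (measurable_inr x0ab k))].
have yL : (fun t : Omega => y (inr t)) \in cLfun m p1.
  rewrite inE; split=> //.
  exact: le_lt_trans (cLnorm_inr_le x0ab k p y p1 (conj mr mi)) yfin.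
(* Only the values of c below k matter. *)
pose c n := if insub n is Some j then y (inl (j : 'I_k)) else 0.
have [f [fk fc]] := sobolev_surjective x0ab p1 k c (Lp_class (CLfun yL)).
exists f; apply: Lp_eq_ae.
have : {ae mu, forall x, glue (fun j => anchor_value j f) (sobolev_derivative k f) x = y x}.
  apply/ae_anchored; split=> [j|]; first by rewrite /= fc// /c valK.
  by rewrite /= fk; exact: ae_Lp_class.
have := anchored_dataP f; apply: filterS2 => x -> ->.
by [].
Qed.

Lemma anchored_data_cone (f : W) :
  Lp_cone mu p1 (anchored_data f) <-> sobolev_cone x0ab p1 k f.
Proof.
have glue0 : Lp_cone mu p1 (anchored_data f) <->
    (forall j : 'I_k, 0 <= anchor_value j f) /\
    {ae m, forall t, 0 <= sobolev_derivative k f t}.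
  rewrite -(ae_anchored x0ab k (fun x => 0 <= glue (fun j => anchor_value j f)
    (sobolev_derivative k f) x)).
  have := anchored_dataP f; rewrite /Lp_cone/= => H.
  by split; move: H; apply: filterS2 => x -> .
apply: (iff_trans glue0); split=> [[A D]|[_ D A]]; last first.
  by split => // j; exact: A.
have A' j (jk : (j < k)%N) : 0 <= anchor_value j f := A (Ordinal jk).
have Im0 (z : R[i]) : 0 <= z -> complex.Im z = 0.
  by case: z => u v; rewrite lecE/= => /andP[/eqP].
split => //; apply: sobolev_real => [|j jk]; last exact: Im0 (A' j jk).
by move: D; apply: filterS => t; exact: Im0.
Qed.

End isomorphism.

Theorem proposition2p1 (R : realType) (p : \bar R) (p1 : (1 <= p)%E)
  (k : nat) (k_gt0 : (0 < k)%N) (a b x0 : R) (x0ab : x0 \in `]a, b[) :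
  exists Phi : {linear sobolev_space x0ab p1 k -> Lp (anchored_measure x0ab k) p1},
    isometric_order_isomorphism
      (sobolev_norm x0ab p1 k) (sobolev_cone x0ab p1 k)
      (Lp_norm (anchored_measure x0ab k) p1) (Lp_cone (anchored_measure x0ab k) p1)
      Phi.
Proof.
exists (anchored_data p1 k x0ab); split.
- by move=> y _; have [f fy] := anchored_data_surjective p1 k x0ab y; exists f.
- exact: anchored_data_norm.
- apply/seteqP; split=> [_ [f Ef <-]|y Fy]; first exact/anchored_data_cone.
  have [f fy] := anchored_data_surjective p1 k x0ab y; exists f => //.
  by apply/anchored_data_cone; rewrite fy.
- by apply/seteqP; split=> f /anchored_data_cone.
Qed.
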